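(* Let $K$ be an algebraically closed field of characteristic $2$ and let $X = \{F = 0\} \subset \mathbb{P}^3_K$ be a normal quartic surface (so $\mathrm{Sing}(X)$ is a finite set). Let $P$ be a double point of $X$ such that the projection $\pi_P$ with centre $P$ is a separable double cover of $\mathbb{P}^2$. Then: I) $|\mathrm{Sing}(X)| \leq 25$. II) Suppose moreover that $P$ is a uniplanar double point, i.e. the tangent quadric at $P$ is a double plane $Q = x_1^2$, where $F = z^2 Q(x) + z G(x) + B(x)$ is the Taylor development of $F$ at $P$. (i) If $x_1$ divides $G$, then $|\mathrm{Sing}(X)| \leq 17$. (ii) If $G(x) = x_1^2 L(x_1,x_2) + x_2 x_3 N(x_1,x_2)$ with $L, N$ linear forms, then $|\mathrm{Sing}(X)| \leq 19$. (iii) If $G(x) = x_1^2 L(x_1,x_2,x_3) + x_1 x_2 M(x_2,x_3) + x_2^3$ with $L, M$ linear forms, then $|\mathrm{Sing}(X)| \leq 19$.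
   Context: $\mathrm{Sing}(X)$ is the set of singular points of $X$, i.e. the points where $F$ and all its partial derivatives vanish. A double point is a point of multiplicity $2$. Taylor development: if $P$ is a double point of $X$, choose homogeneous coordinates $(x_1,x_2,x_3,z)$ on $\mathbb{P}^3$ with $P = \{x_1=x_2=x_3=0,\ z=1\}$ and write $$F(x_1,x_2,x_3,z) = z^2 Q(x) + z\,G(x) + B(x), \qquad x = (x_1,x_2,x_3),$$ with $Q, G, B$ homogeneous of degrees $2,3,4$ respectively and $Q \neq 0$. The projection with centre $P$ is $\pi_P : X \setminus \{P\} \to \mathbb{P}^2$, $(x,z) \mapsto x$; the projection being a separable double cover means that the cubic polynomial $G$ is not identically zero. A notation such as $N(x_1,x_2)$ means that the linear form involves only the variables $x_1,x_2$. *)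

(* Defs.v *)
From HB Require Import structures.
From mathcomp Require Import all_boot all_order all_algebra.
From mathcomp Require Export mpoly.

Set Implicit Arguments.
Unset Strict Implicit.
Unset Printing Implicit Defensive.

Import GRing.Theory.
Local Open Scope ring_scope.

(* A point of P^3 is given by a nonzero row vector p : 'rV[K]_4, up to        *)
(* scaling; F.@[p 0] is the value of F : {mpoly K[4]} at that vector.         *)

Section Surfaces.
Variable K : fieldType.
Implicit Types (F A B D : {mpoly K[4]}) (p v w : 'rV[K]_4) (T : 'M[K]_4).

Definition divides F A : Prop := exists H : {mpoly K[4]}, A = F * H.

Definition irreducible_form F : Prop :=
  [/\ F != 0, F \isn't a GRing.unit &
   forall A B, F = A * B -> A \is a GRing.unit \/ B \is a GRing.unit].

(* For F irreducible, an element of the function field of X = {F = 0} is the  *)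
(* class modulo F of a fraction A / B, with A and B forms of the same degree  *)
(* and B not divisible by F. The local ring O_{X,p} is the subring of classes *)
(* that can be written C / D with D(p) != 0.                                  *)
Definition in_local_ring F p A B : Prop :=
  exists (e : nat) (C D : {mpoly K[4]}),
    [/\ C \is e.-homog, D \is e.-homog, D.@[p 0] != 0 &
        divides F (A * D - C * B)].

(* A / B satisfies a monic equation of degree n over O_{X,p}, namely          *)
(*   (A/B)^n + \sum_(i < n) (c_i / D) (A/B)^i = 0,                            *)
(* multiplied here by D B^n; taking a common denominator D is no restriction. *)
Definition integral_over_local_ring F p A B : Prop :=
  exists (n e : nat) (c : 'I_n -> {mpoly K[4]}) (D : {mpoly K[4]}),
    [/\ forall i, c i \is e.-homog, D \is e.-homog, D.@[p 0] != 0 &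
        divides F (D * A ^+ n + \sum_(i < n) c i * A ^+ i * B ^+ (n - i))].

Definition normal_at F p : Prop :=
  forall (d : nat) A B,
    A \is d.-homog -> B \is d.-homog -> ~ divides F B ->
    integral_over_local_ring F p A B -> in_local_ring F p A B.

Definition normal_surface F : Prop :=
  irreducible_form F /\ (forall p, p != 0 -> F.@[p 0] = 0 -> normal_at F p).

Definition singular_point F p : Prop :=
  [/\ p != 0, F.@[p 0] = 0 & forall i : 'I_4, (F^`M(i)).@[p 0] = 0].

(* Sing(X) is a finite subset of P^3 with at most N elements.                 *)
Definition card_sing_le F (N : nat) : Prop :=
  exists2 s : seq 'rV[K]_4, (size s <= N)%N &
    forall p, singular_point F p -> exists2 q, q \in s & exists c : K, p = c *: q.

(* F(p + x) as a polynomial in x.                                             *)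
Definition translate F p : {mpoly K[4]} :=
  F \mPo [tuple (p 0 i)%:MP + 'X_i | i < 4].

(* Lowest degree occurring in F(p + x). For F a form and p != 0 this is the   *)
(* multiplicity of X at p: locally along the line of p, the affine cone over  *)
(* X is the product of X with a line.                                         *)
Definition multiplicity_is F p (k : nat) : Prop :=
  (forall m, m \in msupp (translate F p) -> (k <= mdeg m)%N) /\
  (exists2 m, m \in msupp (translate F p) & mdeg m = k).

Definition double_point F p : Prop := p != 0 /\ multiplicity_is F p 2.

(* F written in the coordinates y such that the old coordinates are y *m T.   *)
Definition change_coord F T : {mpoly K[4]} :=
  F \mPo [tuple \sum_(j < 4) T j i *: 'X_j | i < 4].

(* The homogeneous coordinates are (x_1, x_2, x_3, z) = ('X_0, 'X_1, 'X_2,    *)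
(* 'X_3), and mwiden views a polynomial in x_1, x_2, x_3 as one in all four.  *)
(* The point x = 0, z = 1 corresponds to the last row of T.                   *)
Definition taylor_development F p T (Q G B : {mpoly K[3]}) : Prop :=
  [/\ T \in unitmx, row ord_max T = p,
      [/\ Q \is 2.-homog, G \is 3.-homog & B \is 4.-homog], Q != 0 &
      change_coord F T =
        'X_ord_max ^+ 2 * mwiden Q + 'X_ord_max * mwiden G + mwiden B].

End Surfaces.

Definition x1 {K : fieldType} : {mpoly K[3]} := 'X_(@Ordinal 3 0 isT).
Definition x2 {K : fieldType} : {mpoly K[3]} := 'X_(@Ordinal 3 1 isT).
Definition x3 {K : fieldType} : {mpoly K[3]} := 'X_(@Ordinal 3 2 isT).

(* Main.v *)
Require Import Defs.
From HB Require Import structures.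
From mathcomp Require Import all_boot all_order all_algebra.
From mathcomp Require Import ring zify.
From Stdlib Require Import Classical.

(** In suitable coordinates the surface is F = z^2 Q + z G + B, and dF/dz = G
    because the characteristic is 2. Hence a singular point (x, z) other than
    the centre P lies over a point x of the plane cubic G = 0, and there
    z^2 Q = B and z^2 Q_i + z G_i + B_i = 0, where the index i denotes the
    i-th partial derivative. The proof counts the points x on each irreducible
    component of the cubic, and the values of z over each x.

    The points x. The resultant in z of z^2 Q + B and z^2 Q_i + z G_i + B_i
    is W_i = ((Q B)_i)^2 + Q B (G_i)^2, a form of degree 10, so W_i vanishes at
    x. It does so doubly along the cubic: squares have zero derivative, and at
    x the derivative of Q B along the cubic is zero too
    ([singular_height_resultant_tangent]). By the Bezout bound with
    multiplicity two ([double_bezout]) a component g of degree d carries at most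
    5 d such points x as soon as there is an i for which g does not divide W_i.
    When g does not divide Q, normality provides it: if g divided every W_i,
    there would be explicit forms a and b such that (z a + b) / g is integral over
    the local ring of a suitable point with g = 0, while a derivative in z shows
    that such a fraction does not belong to that ring ([not_normal_of_integral_fraction],
    [not_rdvd_height_resultant]).

    The values of z. Three values over the same x, or two when all the Q_i
    vanish at x, force Q, G, B and all their partial derivatives to vanish at
    x, so that the line joining x to P is singular. Then F is a binary
    quadratic form in two linear forms vanishing on that line, and a ratio of
    linear forms is integral but not regular at P
    ([not_normal_of_singular_line]). If Q(x) is not zero, z^2 = B(x) / Q(x)
    leaves one value.

    Totals. A component g of degree d that does not divide Q carries at most
    5 d points x, of which at most 2 d satisfy Q(x) = 0, hence at most 7 d
    singular points. If g divides Q, then B vanishes at the points x, while g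
    does not divide B because F is irreducible; this gives 4 d points x and
    8 d singular points. The degrees d add up to 3, so with P there are at most
    8 * 3 + 1 = 25 singular points. If Q is the square of a linear form, there
    is one z over each x, and at most 5 * 3 + 1 = 16 singular points, which
    is below the three bounds of the uniplanar case.

    The algebra behind this is unique factorization in polynomial rings
    ([mpoly_irreducibles_prime]), the Nullstellensatz for one hypersurface
    ([nullstellensatz_hypersurface]), and a dimension count in a graded piece
    of K[x1, x2, x3] for [double_bezout]. *)

Set Implicit Arguments.
Unset Strict Implicit.
Unset Printing Implicit Defensive.

Import GRing.Theory.
Local Open Scope ring_scope.

(** * Divisibility and the Gauss lemma *)

Definition rdvd (R : comNzRingType) (a b : R) : Prop := exists c, b = a * c.

Definition irreducible (R : idomainType) (p : R) : Prop :=
  [/\ p != 0, p \isn't a GRing.unit &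
   forall a b, p = a * b -> a \is a GRing.unit \/ b \is a GRing.unit].

Definition prime_elt (R : idomainType) (p : R) : Prop :=
  [/\ p != 0, p \isn't a GRing.unit &
   forall a b, rdvd p (a * b) -> rdvd p a \/ rdvd p b].

Definition irreducibles_prime (R : idomainType) : Prop :=
  forall p : R, irreducible p -> prime_elt p.

(** Factorization of nonzero elements into primes, in the form in which it is
    used: as an induction principle that strips one prime factor at a time. *)
Definition prime_products (R : idomainType) : Prop :=
  forall P : R -> Prop,
    (forall c, c \is a GRing.unit -> P c) ->
    (forall p c, prime_elt p -> c != 0 -> P c -> P (p * c)) ->
    forall c, c != 0 -> P c.

Section Dvd.
Variable R : comNzRingType.
Implicit Types a b c : R.

Lemma rdvdxx a : rdvd a a. Proof. by exists 1; rewrite mulr1. Qed.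
Lemma rdvd0 a : rdvd a 0. Proof. by exists 0; rewrite mulr0. Qed.
Lemma rdvd_mull a b c : rdvd a c -> rdvd a (b * c).
Proof. by case=> d ->; exists (b * d); rewrite mulrCA. Qed.
Lemma rdvd_mulr a b c : rdvd a b -> rdvd a (b * c).
Proof. by move=> h; rewrite mulrC; apply: rdvd_mull. Qed.
Lemma rdvdD a b c : rdvd a b -> rdvd a c -> rdvd a (b + c).
Proof. by move=> [d ->] [e ->]; exists (d + e); rewrite mulrDr. Qed.
Lemma rdvdN a b : rdvd a b -> rdvd a (- b).
Proof. by move=> [d ->]; exists (- d); rewrite mulrN. Qed.
Lemma rdvdB a b c : rdvd a b -> rdvd a c -> rdvd a (b - c).
Proof. by move=> h k; apply: rdvdD => //; apply: rdvdN. Qed.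
Lemma rdvd_trans a b c : rdvd a b -> rdvd b c -> rdvd a c.
Proof. by move=> h [d ->]; apply: rdvd_mulr. Qed.
End Dvd.

Lemma reducible_factors (R : idomainType) (p : R) :
  p != 0 -> p \isn't a GRing.unit -> ~ irreducible p ->
  exists a b, [/\ p = a * b, a \isn't a GRing.unit & b \isn't a GRing.unit].
Proof.
move=> p0 pU nirr; apply: NNPP => h; apply: nirr; split=> // a b pab.
case: (boolP (a \is a GRing.unit)) => [|aU]; [by left|right].
by apply/negPn/negP => bU; apply: h; exists a, b.
Qed.

Section Gauss.
Variable R : idomainType.
Hypothesis Rprod : prime_products R.
Hypothesis Rprime : irreducibles_prime R.
Implicit Types (p q a b : {poly R}) (c : R).

Lemma rdvd_polyC c p : rdvd c%:P p <-> forall i, rdvd c p`_i.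
Proof.
split=> [[q ->] i|h]; first by rewrite coefCM; exists q`_i.
have /all_sig q i : {d | p`_i == c * d}.
  by apply: sigW; have [d ->] := h i; exists d.
exists (\poly_(i < size p) sval q i).
apply/polyP => i; rewrite coefCM coef_poly.
case: ltnP => [_|/leq_sizeP ->//]; last by rewrite mulr0.
exact/eqP/(svalP q i).
Qed.

(** The lowest coefficients of a and b that are not divisible by c contribute a
    product to a * b that no other term of the same degree can compensate. *)
Lemma prime_polyC c : prime_elt c -> prime_elt c%:P.
Proof.
case=> c0 cU cP; split; first by rewrite polyC_eq0.
  by rewrite poly_unitE coefC eqxx negb_and cU orbT.
move=> a b /rdvd_polyC cab.
case: (classic (rdvd c%:P a)) => [|na]; [by left | right].
case: (classic (rdvd c%:P b)) => // nb.
have first_bad p : ~ rdvd c%:P p ->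
    exists2 i, ~ rdvd c p`_i & forall j, (j < i)%N -> rdvd c p`_j.
  move=> np; have [i hi] : exists i, ~ rdvd c p`_i.
    by apply: not_all_ex_not => h; apply: np; apply/rdvd_polyC.
  elim/ltn_ind: i hi => i IH hi.
  case: (classic (exists2 j, (j < i)%N & ~ rdvd c p`_j)) => [[j ji hj]|h].
    exact: IH ji hj.
  by exists i => // j ji; apply: NNPP => hj; apply: h; exists j.
have [i hi Hi] := first_bad a na; have [j hj Hj] := first_bad b nb.
have := cab (i + j)%N; rewrite coefM.
have lt_i : (i < (i + j).+1)%N by rewrite ltnS leq_addr.
rewrite (bigD1 (Ordinal lt_i)) //= addKn => h.
suff : rdvd c (a`_i * b`_j) by case/cP.
rewrite -[X in rdvd c X](addrK (\sum_(k < (i + j).+1 | k != Ordinal lt_i)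
  a`_k * b`_(i + j - k))); apply: rdvdB => //.
apply: (big_ind (fun x => rdvd c x)) => [|x y|k kP]; [exact: rdvd0|exact: rdvdD|].
case: (ltnP k i) => ki; first exact/rdvd_mulr/Hi.
apply/rdvd_mull/Hj; have : k != i :> nat by rewrite -val_eqE in kP.
have := ltn_ord k; move: ki; rewrite leq_eqVlt eq_sym => /orP[->//|ki].
by move=> kij _; rewrite ltn_subLR // ltn_add2r.
Qed.

(** A nonconstant irreducible polynomial is primitive, so the primes of R that
    divide c can be moved to the cofactor one after another. Together with
    [split_scale] this replaces the passage to the fraction field of R. *)
Lemma rdvd_cancel_scale p : irreducible p -> (1 < size p)%N ->
  forall c, c != 0 -> forall a, rdvd p (c%:P * a) -> rdvd p a.
Proof.
move=> [p0 pU pI] sp.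
have dvdC d : rdvd d%:P p -> d \is a GRing.unit.
  case=> q pq; have [|] := pI _ _ pq; first by rewrite poly_unitE coefC /= => /andP[].
  rewrite poly_unitE => /andP[/eqP sq _]; move: sp; rewrite pq.
  by rewrite ltnNge (leq_trans (size_polyMleq _ _)) // sq addn1 size_polyC; case: (d != 0).
apply: Rprod => [c cU a [q e]|d c dP c0 IH a [q e]].
  exists (c^-1%:P * q); rewrite mulrCA -e mulrA -polyCM mulVr // polyC1 mul1r //.
apply: IH; have [d0 dU /(_ p q)] := prime_polyC dP.
have dpq : rdvd d%:P (p * q) by exists (c%:P * a); rewrite -e polyCM mulrA.
case=> //.
- by move/dvdC; case: dP => _ /negP.
- case=> r eq; exists r; apply: (mulfI d0).
  by rewrite mulrA -polyCM e eq mulrCA.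
Qed.

(** Each prime factor of c divides a or b, and can be cancelled there. *)
Lemma split_scale p : p != 0 -> forall c, c != 0 ->
  forall a b, c%:P * p = a * b ->
  exists a' b', [/\ p = a' * b', size a' = size a & size b' = size b].
Proof.
move=> p0; apply: Rprod => [c cU a b e|d c dP c0 IH a b e].
  exists (c^-1%:P * a), b; split=> //.
    by rewrite -mulrA -e mulrA -polyCM mulVr // polyC1 mul1r.
  by rewrite mul_polyC size_scale // invr_eq0; apply: contraTneq cU => ->; rewrite unitr0.
have [d0 dU /(_ a b)] := prime_polyC dP.
have dab : rdvd d%:P (a * b) by exists (c%:P * p); rewrite -e polyCM mulrA.
case=> // [[a1 ea]|[b1 eb]].
- have sd : d != 0 by case: dP.
  have [|a' [b' [h1 h2 h3]]] := IH a1 b.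
    by apply: (mulfI d0); rewrite mulrA -polyCM e ea mulrA.
  by exists a', b'; split=> //; rewrite h2 ea mul_polyC size_scale.
- have sd : d != 0 by case: dP.
  have [|a' [b' [h1 h2 h3]]] := IH a b1.
    by apply: (mulfI d0); rewrite mulrA -polyCM e eb mulrCA.
  by exists a', b'; split=> //; rewrite h3 eb mul_polyC size_scale.
Qed.

(** The pseudo-gcd of p and q divides a multiple c p; by [split_scale] the
    factorization of c p descends to p, so the gcd has degree 0 or that of p. *)
Lemma irreducible_coprimep p q : irreducible p -> (1 < size p)%N ->
  coprimep p q \/ rdvd p q.
Proof.
move=> pirr sp; have [p0 pU pI] := pirr.
set d := gcdp p q; case: (boolP (coprimep p q)) => [|ncop]; [by left|right].
have /Pdiv.WeakIdomain.dvdpP[[c e] /= c0 ce] : d %| p by exact: dvdp_gcdl.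
have d0 : d != 0 by rewrite gcdp_eq0 negb_and p0.
have sd : (1 < size d)%N.
  move: ncop; rewrite coprimep_def -/d; case: (size d) (size_poly_gt0 d) => [|[]] //=.
  by rewrite d0.
have [|e' [d' [h1 h2 h3]]] := @split_scale p p0 c c0 e d; first by rewrite mul_polyC.
have {h2} : (size e <= 1)%N.
  rewrite leqNgt; apply/negP => se.
  by have [] := pI _ _ h1; rewrite poly_unitE ?h2 ?h3 (gtn_eqF) //.
move=> se; have /Pdiv.WeakIdomain.dvdpP[[c2 r] /= c20 er] : p %| q.
  apply: dvdp_trans (dvdp_gcdr p q); rewrite -/d.
  have e0 : e != 0.
    apply: contra_eq_neq ce => ->; rewrite mul0r -mul_polyC mulf_neq0 // polyC_eq0 //.
  have /size_poly1P [k k0 ke] : size e == 1%N.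
    by rewrite eqn_leq se size_poly_gt0.
  by apply/Pdiv.WeakIdomain.dvdpP; exists (k, c%:P) => //=; rewrite mul_polyC ce ke mul_polyC.
apply: (rdvd_cancel_scale pirr sp c20); exists r.
by rewrite mul_polyC er mulrC.
Qed.

(** Degree 0 reduces to R; in positive degree p is either coprime to a or
    divides it, and in the first case pseudo-division gives p | c b. *)
Lemma poly_irreducibles_prime : irreducibles_prime {poly R}.
Proof.
move=> p pirr; have [p0 pU pI] := pirr.
have [sp|sp] := ltnP 1 (size p).
  split=> // a b pab.
  have [cop|] := irreducible_coprimep a pirr sp; [right|by left].
  have : p %| b.
    rewrite -(Gauss_dvdpr _ cop).
    by case: pab => q ->; apply: dvdp_mulIl.
  case/Pdiv.WeakIdomain.dvdpP => [[c r] /= c0 e]; apply: (rdvd_cancel_scale pirr sp c0); exists r.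
  by rewrite mul_polyC e mulrC.
have /size_poly1P [c c0 pc] : size p == 1%N by rewrite eqn_leq sp size_poly_gt0.
rewrite pc; apply/prime_polyC/Rprime; split=> // [|a b cab].
  by apply: contra pU; rewrite pc poly_unitE size_polyC c0 coefC.
have [] := pI a%:P b%:P; first by rewrite pc cab polyCM.
  by rewrite poly_unitE coefC => /andP[_ ->]; left.
by rewrite poly_unitE coefC => /andP[_ ->]; right.
Qed.

End Gauss.

(** * Unique factorization for polynomials in several variables *)

Lemma lift_ord_max n (j : 'I_n) : lift ord_max j = widen_ord (leqnSn n) j.
Proof. by apply: val_inj; rewrite /= /bump leqNgt ltn_ord. Qed.

Section Muni.
Variables (n : nat) (R : idomainType).

(** The inverse of [muni], as an evaluation, so that it is a ring morphism. *)
Definition muni_inv (p : {poly {mpoly R[n]}}) : {mpoly R[n.+1]} :=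
  (map_poly (@mwiden n R) p).['X_ord_max].

Fact muni_inv_is_additive : zmod_morphism muni_inv.
Proof. by move=> p q; rewrite /muni_inv raddfB hornerD hornerN. Qed.
HB.instance Definition _ := GRing.isZmodMorphism.Build _ _ muni_inv muni_inv_is_additive.
Fact muni_inv_is_multiplicative : monoid_morphism muni_inv.
Proof. by split=> [|p q]; rewrite /muni_inv ?rmorph1 ?hornerC // rmorphM hornerM. Qed.
HB.instance Definition _ := GRing.isMonoidMorphism.Build _ _ muni_inv muni_inv_is_multiplicative.

Lemma muni_X (i : 'I_n) : muni 'X_(widen_ord (leqnSn n) i) = ('X_i)%:P :> {poly {mpoly R[n]}}.
Proof.
rewrite muniE msuppX big_seq1 mcoeffX eqxx scale1r mnm1E -val_eqE /= ltn_eqF //.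
rewrite expr0 alg_polyC; congr ('X_[_])%:P; apply/mnmP => j.
by rewrite mnmE !mnm1E -!val_eqE.
Qed.

Lemma muni_Xmax : muni 'X_ord_max = 'X :> {poly {mpoly R[n]}}.
Proof.
rewrite muniE msuppX big_seq1 mcoeffX eqxx scale1r mnm1E eqxx expr1.
rewrite (_ : [multinom _ | _ < _] = 0%MM) ?mpolyX0 ?scale1r //.
by apply/mnmP => j; rewrite mnmE mnm1E mnm0E -val_eqE /= gtn_eqF.
Qed.

Lemma mpoly_rmorph_ext (m : nat) (S : comNzRingType) (f g : {rmorphism {mpoly R[m]} -> S}) :
  (forall c, f c%:MP = g c%:MP) -> (forall i, f 'X_i = g 'X_i) -> f =1 g.
Proof.
move=> fgC fgX p; elim/mpolyind: p => [|c u p _ _ IH]; first by rewrite !rmorph0.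
rewrite !rmorphD IH -mul_mpolyC !rmorphM fgC mpolyXE_id !rmorph_prod.
by congr (_ * _ + _); apply: eq_bigr => i _; rewrite !rmorphXn fgX.
Qed.

Lemma muniK : cancel (@muni n R) muni_inv.
Proof.
move=> p; apply: (mpoly_rmorph_ext (f := muni_inv \o @muni n R) (g := idfun)) => [c|i] /=.
  by rewrite muniC /muni_inv map_polyC /= hornerC mwidenC.
case: (unliftP ord_max i) => [j ->|->].
  rewrite lift_ord_max muni_X /muni_inv map_polyC /= hornerC mwidenX; congr 'X_[_].
  by rewrite mnmwiden1.
by rewrite muni_Xmax /muni_inv map_polyX hornerX.
Qed.

Lemma muni_mwiden p : muni (mwiden p) = p%:P :> {poly {mpoly R[n]}}.
Proof.
apply: (mpoly_rmorph_ext (f := @muni n R \o @mwiden n R) (g := polyC)) => [c|i] /=.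
  by rewrite mwidenC muniC.
by rewrite mwidenX mnmwiden1 muni_X.
Qed.

Lemma muni_invK : cancel muni_inv (@muni n R).
Proof.
move=> p; elim/poly_ind: p => [|p c IH]; first by rewrite rmorph0 muni0.
rewrite rmorphD rmorphM /=.
have invX : muni_inv 'X = 'X_ord_max by rewrite /muni_inv map_polyX hornerX.
have invC : muni_inv c%:P = mwiden c by rewrite /muni_inv map_polyC /= hornerC.
by rewrite invX invC muniD muniM IH muni_Xmax muni_mwiden.
Qed.

End Muni.

Section RingIso.
Variables (R S : idomainType) (f : {rmorphism R -> S}) (g : {rmorphism S -> R}).
Hypotheses (fK : cancel f g) (gK : cancel g f).

Lemma iso_unit x : (f x \is a GRing.unit) = (x \is a GRing.unit).
Proof.
apply/idP/idP => [fxU|]; last exact: rmorph_unit.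
by rewrite -[x]fK rmorph_unit.
Qed.

Lemma iso_rdvd x y : rdvd (f x) (f y) <-> rdvd x y.
Proof.
split=> [] [c e]; last by exists (f c); rewrite e rmorphM.
by exists (g c); rewrite -[y]fK e rmorphM fK.
Qed.

Lemma iso_irreducible x : irreducible x -> irreducible (f x).
Proof.
case=> x0 xU xI; split=> [||a b e].
- by apply: contraNneq x0 => /(congr1 g); rewrite fK rmorph0 => ->.
- by rewrite iso_unit.
- by rewrite -[a]gK -[b]gK !iso_unit; apply: xI; rewrite -rmorphM -e fK.
Qed.

Lemma iso_prime x : prime_elt (f x) -> prime_elt x.
Proof.
case=> x0 xU xP; split=> [||a b xab].
- by apply: contraNneq x0 => ->; rewrite rmorph0.
- by rewrite -iso_unit.
- by rewrite -!iso_rdvd; apply: xP; rewrite -rmorphM iso_rdvd.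
Qed.
End RingIso.

Section MpolyUFD.
Variable K : fieldType.

Lemma mpoly_unitP n (p : {mpoly K[n]}) :
  reflect (exists2 c, c != 0 & p = c%:MP) (p \is a GRing.unit).
Proof.
apply: (iffP idP) => [/andP[/eqP e]|[c c0 ->]].
  by rewrite unitfE => u; exists p@_0%MM.
by rewrite rmorph_unit // unitfE.
Qed.

Lemma mpoly_unit_msize n (p : {mpoly K[n]}) : (p \is a GRing.unit) = (msize p == 1%N).
Proof. exact: (sameP (mpoly_unitP p) (msize_poly1P p)). Qed.

Lemma mpoly_prime_products n :
  irreducibles_prime {mpoly K[n]} -> prime_products {mpoly K[n]}.
Proof.
move=> irrP P Punit Pmul.
have fac : forall k (c : {mpoly K[n]}), (msize c <= k)%N -> c != 0 -> c \isn't a GRing.unit ->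
    exists p d, prime_elt p /\ c = p * d.
  elim=> [|k IH] c sc c0 cU.
    by move: sc; rewrite leqn0 msize_poly_eq0 (negPf c0).
  case: (classic (irreducible c)) => [ci|ni].
    by exists c, 1; split; [exact: irrP|rewrite mulr1].
  have [a [b [cab aU bU]]] := reducible_factors c0 cU ni.
  have a0 : a != 0 by apply: contraNneq c0 => a0; rewrite cab a0 mul0r.
  have b0 : b != 0 by apply: contraNneq c0 => b0; rewrite cab b0 mulr0.
  have [|//|//|p [d [pP ad]]] := IH a.
    move: sc; rewrite cab msizeM //; move: bU; rewrite mpoly_unit_msize.
    rewrite -msize_poly_eq0 in b0; case: (msize b) b0 => [|[|m]] // _ _.
    by rewrite !addnS /= ltnS; apply: leq_trans; rewrite leq_addr.
  by exists p, (d * b); rewrite cab ad mulrA.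
move=> c; have [k sc] : exists k, (msize c <= k)%N by exists (msize c).
elim: k c sc => [|k IH] c sc c0.
  by move: sc; rewrite leqn0 msize_poly_eq0 (negPf c0).
case: (boolP (c \is a GRing.unit)) => [|cU]; first exact: Punit.
have [p [d [pP cpd]]] := fac _ c (leqnn _) c0 cU.
have d0 : d != 0 by apply: contraNneq c0 => d0; rewrite cpd d0 mulr0.
rewrite cpd; apply: Pmul => //; apply: IH => //.
have [p0 pU _] := pP; move: sc pU; rewrite cpd msizeM // mpoly_unit_msize.
rewrite -msize_poly_eq0 in p0; case: (msize p) p0 => [|[|m]] // _.
by rewrite !addSn /= ltnS => h _; apply: leq_trans h; rewrite leq_addl.
Qed.

(** Induction on the number of variables, by viewing a polynomial in n + 1
    variables as a polynomial in the last one. *)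
Theorem mpoly_irreducibles_prime n : irreducibles_prime {mpoly K[n]}.
Proof.
elim: n => [|n IH] p pirr.
  by case: pirr => p0 /negP[]; apply/mpoly_unitP; exists p@_0%MM;
     [apply: contraNneq p0 => e|]; rewrite {1}(nvar0_mpolyC p) ?e.
apply: (iso_prime (f := @muni n K) (g := @muni_inv n K)); first exact: muniK.
apply: poly_irreducibles_prime => //; first exact: mpoly_prime_products.
by apply: iso_irreducible pirr; [exact: muniK|exact: muni_invK].
Qed.

Lemma prime_dvdM n (p a b : {mpoly K[n]}) :
  irreducible p -> rdvd p (a * b) -> rdvd p a \/ rdvd p b.
Proof. by case/mpoly_irreducibles_prime => _ _; apply. Qed.

Lemma rdvd_msize n (p q : {mpoly K[n]}) : rdvd p q -> q != 0 -> (msize p <= msize q)%N.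
Proof.
case=> d -> ; rewrite mulf_eq0 negb_or => /andP[p0 d0]; rewrite msizeM //.
rewrite -msize_poly_eq0 in d0; case: (msize d) d0 => // m _.
by rewrite addnS leq_addr.
Qed.

Lemma dhomog_msizeE n d (p : {mpoly K[n]}) : p \is d.-homog -> p != 0 -> msize p = d.+1.
Proof.
move=> pd p0; have := dhomog_msize pd.
by move/(dhomog_uniq p0 pd) => ->; rewrite prednK // lt0n msize_poly_eq0.
Qed.

Lemma mcoeff_mlastM n (a b : {mpoly K[n]}) :
  (a * b)@_(mlast a + mlast b) = a@_(mlast a) * b@_(mlast b).
Proof.
have [->|nz_p] := eqVneq a 0; first by rewrite mul0r !mcoeff0 mul0r.
have [->|nz_q] := eqVneq b 0; first by rewrite mulr0 !mcoeff0 mulr0.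
rewrite mpolyME (bigD1_seq (mlast a, mlast b)) /=; first last.
+ by rewrite allpairs_uniq => // -[? ?] [].
+ by rewrite allpairs_f// !mlast_supp.
rewrite mcoeffD mcoeffZ mcoeffX eqxx mulr1.
rewrite big_seq_cond raddf_sum /= big1 ?addr0 //.
case=> m1 m2 /andP[/allpairsP[[x y] /= [h1 h2 [-> ->]]]] {m1 m2}.
move: h1 h2 => /mlast_lemc m1_in_p /mlast_lemc m2_in_q; rewrite xpair_eqE => ne.
rewrite mcoeffZ mcoeffX; case: eqP => [e|]; last by rewrite mulr0.
move: m1_in_p; rewrite Order.POrderTheory.le_eqVlt => /orP[/eqP e1|lt].
  move: e ne; rewrite -e1 eqxx => /eqP; rewrite eqm_add2l => /eqP ->.
  by rewrite eqxx.
have := lt; rewrite -(ltmc_add2l _ _ (mlast b)) -e => lt2.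
suff : ((x + y)%MM < (x + y)%MM)%O by rewrite Order.POrderTheory.ltxx.
by apply: Order.POrderTheory.lt_le_trans lt2 _; rewrite lemc_add2r.
Qed.

(** The top degree of a product is the sum of the top degrees and the lowest
    degree the sum of the lowest degrees, so both gaps are zero. *)
Lemma dhomog_factor n d (a b : {mpoly K[n]}) : a * b \is d.-homog -> a * b != 0 ->
  a \is (msize a).-1.-homog.
Proof.
move=> abd ab0; have := ab0; rewrite mulf_eq0 negb_or => /andP[a0 b0].
have low (p : {mpoly K[n]}) : p != 0 -> forall m, m \in msupp p ->
    (mdeg (mlast p) <= mdeg m <= mdeg (mlead p))%N.
  move=> p0 m mp; apply/andP; split; apply: lemc_mdeg.
    exact: mlast_lemc.
  exact: msupp_le_mlead.
have e1 : (mdeg (mlast a) + mdeg (mlast b) = d)%N.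
  rewrite -mdegD; apply: (dhomog_mf abd); rewrite mcoeff_msupp mcoeff_mlastM.
  by rewrite mulf_neq0 // -mcoeff_msupp mlast_supp.
have e2 : (mdeg (mlead a) + mdeg (mlead b) = d)%N.
  by rewrite -mdegD -mleadM //; apply: (dhomog_mf abd); exact: mlead_supp.
have lab := low b b0 _ (mlead_supp b0); apply/dhomogP => m ma /=.
rewrite -(mlead_deg a0) /=.
have /andP[h1 h2] := low a a0 m ma; have /andP[h3 _] := lab.
apply/eqP; rewrite eqn_leq h2 /=.
apply: leq_trans h1; rewrite -(leq_add2r (mdeg (mlead b))) e2 -e1 leq_add2l.
exact: h3.
Qed.
End MpolyUFD.

(** * Points on hypersurfaces *)

Definition extend_point (T : Type) n (v : 'I_n -> T) (t : T) : 'I_n.+1 -> T :=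
  fun i => if unlift ord_max i is Some j then v j else t.

Section Points.
Variable K : closedFieldType.

(** A nonconstant f takes the value 1, at a root of f - 1. *)
Lemma poly_nonroot (f : {poly K}) : f != 0 -> exists x, f.[x] != 0.
Proof.
move=> f0; have [sf|sf] := ltnP 1 (size f); last first.
  have /size_poly1P [c c0 ->] : size f == 1%N by rewrite eqn_leq sf size_poly_gt0.
  by exists 0; rewrite hornerC.
have : size (f - 1) != 1%N.
  by rewrite size_polyDl ?size_polyN ?size_poly1 // gtn_eqF.
case/closed_rootP => x; rewrite rootE !hornerE subr_eq0 => /eqP fx.
by exists x; rewrite fx oner_eq0.
Qed.


Lemma meval_muni n (p : {mpoly K[n.+1]}) v t :
  p.@[extend_point v t] = (map_poly (meval v) (muni p)).[t].
Proof.
pose f : {rmorphism _ -> _} := horner_eval t \o map_poly (meval v) \o @muni n K.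
apply: (mpoly_rmorph_ext (f := meval (extend_point v t)) (g := f)) => [c|i].
  by rewrite /f /= mevalC muniC map_polyC /= mevalC /horner_eval hornerC.
rewrite /= mevalXU /f /horner_eval /extend_point.
case: (unliftP ord_max i) => [j ->|->] /=.
  by rewrite lift_ord_max muni_X map_polyC /= hornerC mevalXU.
by rewrite muni_Xmax map_polyX hornerX.
Qed.

Lemma map_poly_meval_neq0 n (v : 'I_n -> K) (q : {poly {mpoly K[n]}}) i :
  (q`_i).@[v] != 0 -> map_poly (meval v) q != 0.
Proof.
by move=> h; apply: contraNneq h => /(congr1 (fun r : {poly K} => r`_i)); rewrite coef0 coef_map /= => ->.
Qed.

Lemma mpoly_nonzero_point n (p : {mpoly K[n]}) : p != 0 -> exists v, p.@[v] != 0.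
Proof.
elim: n p => [|n IH] p p0.
  by exists (fun=> 0); rewrite (nvar0_mpolyC p) mevalC; apply: contraNneq p0 => e; rewrite (nvar0_mpolyC p) e.
have : lead_coef (muni p) != 0.
  rewrite lead_coef_eq0; apply: contraNneq p0 => /(congr1 (@muni_inv n K)).
  by rewrite muniK rmorph0 => ->.
case/IH => v /map_poly_meval_neq0 /poly_nonroot [t ht].
by exists (extend_point v t); rewrite meval_muni.
Qed.

Lemma rmorph_combination_eq0 (A B : comNzRingType) (f : {rmorphism A -> B}) (a b c u v : A) :
  f a = 0 -> f b = 0 -> f (c * (u * a + v * b)) = 0.
Proof. by move=> fa fb; rewrite rmorphM rmorphD !rmorphM fa fb !mulr0 addr0 mulr0. Qed.

(** If the last variable occurs in g, a Bezout relation c = u g + v h with c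
    free of that variable shows that any root of g above a point where c and
    the leading coefficient of g do not vanish is no zero of h. Otherwise g
    lives in fewer variables and does not divide some coefficient of h. *)
Lemma nullstellensatz_hypersurface n (g h : {mpoly K[n]}) :
  irreducible g -> ~ rdvd g h -> exists v, g.@[v] = 0 /\ h.@[v] != 0.
Proof.
elim: n g h => [|n IH] g h girr gh.
  case: girr => g0 /negP[]; apply/mpoly_unitP; exists g@_0%MM; last exact: nvar0_mpolyC.
  by apply: contraNneq g0 => e; rewrite (nvar0_mpolyC g) e.
set G := muni g; set H := muni h.
have Girr : irreducible G := iso_irreducible (@muniK n K) (@muni_invK n K) girr.
have GH : ~ rdvd G H by rewrite /G /H (iso_rdvd (@muniK n K)).
have [G0 GU GI] := Girr.
have Kprime := @mpoly_irreducibles_prime K n.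
have Kprod := mpoly_prime_products Kprime.
have [sG|sG] := ltnP 1 (size G).
  have [|//] := irreducible_coprimep Kprod H Girr sG.
  case/Bezout_coprimepP => -[u v] /= /eqpP [[c1 c2]] /= /andP[c10 c20] e.
  have : c2 * lead_coef G != 0 by rewrite mulf_neq0 // lead_coef_eq0.
  case/mpoly_nonzero_point => w; rewrite mevalM mulf_eq0 negb_or => /andP[c2w lw].
  have sGw : size (map_poly (meval w) G) != 1%N.
    by rewrite size_map_poly_id0 // gtn_eqF.
  have /closed_rootP [t /rootP rt] := sGw.
  exists (extend_point w t); rewrite !meval_muni -/G -/H; split=> //.
  apply: contraNneq c2w => hw.
  have [f fE] : exists f : {rmorphism {poly {mpoly K[n]}} -> K},
      forall q, f q = (map_poly (meval w) q).[t].
    by exists (horner_eval t \o map_poly (meval w)).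
  have fG : f G = 0 by rewrite fE rt.
  have fH : f H = 0 by rewrite fE hw.
  have fC c : f c%:P = c.@[w] by rewrite fE map_polyC hornerC.
  rewrite -!mul_polyC mulr1 in e.
  by rewrite -fC -e (rmorph_combination_eq0 _ _ _ fG fH).
have /size_poly1P [g0 g00 Gg0] : size G == 1%N by rewrite eqn_leq sG size_poly_gt0.
have [i hi] : exists i, ~ rdvd g0 H`_i.
  by apply: not_all_ex_not => hall; apply: GH; rewrite Gg0; apply/rdvd_polyC.
have [||v [v1 v2]] := IH g0 H`_i => //.
  split=> // [|a b eab].
    by apply: contra GU; rewrite Gg0; apply: rmorph_unit.
  have [] := GI a%:P b%:P; first by rewrite Gg0 eab polyCM.
    by rewrite poly_unitE coefC => /andP[_ ->]; left.
  by rewrite poly_unitE coefC => /andP[_ ->]; right.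
have [t ht] := poly_nonroot (map_poly_meval_neq0 v2).
exists (extend_point v t); rewrite !meval_muni -/G -/H; split=> //.
by rewrite Gg0 map_polyC hornerC.
Qed.

End Points.

(** * Forms and their derivatives *)

Lemma mdeg_gt0_index n (m : 'X_{1..n}) : (0 < mdeg m)%N -> exists i, m i != 0%N.
Proof.
move=> dm; apply: NNPP => h; move: dm; rewrite mdegE big1 // => i _.
by apply/eqP/negPn/negP => mi; apply: h; exists i.
Qed.

Lemma meval_homog0 (K : fieldType) n k (p : {mpoly K[n]}) (v : 'I_n -> K) :
  p \is k.+1.-homog -> (forall i, v i = 0) -> p.@[v] = 0.
Proof.
move=> pk v0; rewrite mevalE big_seq big1 // => m /(dhomog_mf pk) /= dm.
have [|i mi] := @mdeg_gt0_index _ m; first by rewrite dm.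
by rewrite (bigD1 i) //= v0 expr0n (negPf mi) mul0r mulr0.
Qed.

Lemma meval_homog_scale (K : fieldType) n d (p : {mpoly K[n]}) (c : K) (v w : 'I_n -> K) :
  p \is d.-homog -> (forall i, w i = c * v i) -> p.@[w] = c ^+ d * p.@[v].
Proof.
move=> pd wv; rewrite !mevalE mulr_sumr big_seq [RHS]big_seq; apply: eq_bigr => m mp.
rewrite mulrCA; congr (_ * _); rewrite -(dhomog_mf pd mp) /= mdegE -prodrXr -big_split.
by apply: eq_bigr => i _; rewrite wv exprMn.
Qed.

Lemma mderiv_homog (K : fieldType) n d (p : {mpoly K[n]}) i : p \is d.+1.-homog -> p^`M(i) \is d.-homog.
Proof.
move=> pd; apply/dhomogP => m mp.
have : (m + U_(i))%MM \in msupp p.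
  by move: mp; rewrite !mcoeff_msupp mcoeff_mderiv; apply: contraNneq => ->; rewrite mul0rn.
by move/(dhomog_mf pd); rewrite /= mdegD mdeg1 addn1 => -[].
Qed.

Lemma mpolyX_split (K : fieldType) n (m : 'X_{1..n}) k : mdeg m = k.+1 ->
  exists i m', mdeg m' = k /\ 'X_[m] = 'X_[m'] * 'X_i :> {mpoly K[n]}.
Proof.
move=> dm; have [|i mi] := @mdeg_gt0_index _ m; first by rewrite dm.
have le : (U_(i) <= m)%MM by rewrite lep1mP.
exists i, (m - U_(i))%MM; split; last by rewrite -mpolyXD submK.
by apply/eqP; rewrite -eqSS -dm -{2}(submK le) mdegD mdeg1 addn1.
Qed.

Section Widen.
Variables (n : nat) (K : fieldType).
Implicit Types (p q : {mpoly K[n]}).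
Local Notation widen := (widen_ord (leqnSn n)).

Lemma meval_mwiden (w : 'I_n.+1 -> K) p : (mwiden p).@[w] = p.@[fun i => w (widen i)].
Proof.
apply: (mpoly_rmorph_ext (f := meval w \o @mwiden n K)
  (g := meval (fun i => w (widen i)))) => [c|i] /=.
  by rewrite mwidenC !mevalC.
by rewrite mwidenX mnmwiden1 !mevalXU.
Qed.

Lemma mdeg_mnmwiden (m : 'X_{1..n}) : mdeg (mnmwiden m) = mdeg m.
Proof.
rewrite !mdegE big_ord_recr /= mnmwiden_ordmax addn0.
by apply: eq_bigr => i _; rewrite mnmwiden_widen.
Qed.

Lemma mwiden_homog d p : p \is d.-homog -> mwiden p \is d.-homog.
Proof.
move=> pd; rewrite [p]mpolyE raddf_sum /= big_seq; apply: rpred_sum => m mp.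
by rewrite mwidenZ mwidenX; apply: rpredZ; rewrite dhomogX /= mdeg_mnmwiden (dhomog_mf pd).
Qed.

Lemma mderiv_mwiden p (i : 'I_n) : (mwiden p)^`M(widen i) = mwiden p^`M(i).
Proof.
elim/mpolyind: p => [|c m p _ _ IH]; first by rewrite !(raddf0, mderiv0).
rewrite !(mwidenD, mderivD, mwidenZ, mderivZ) IH !mwidenX !mderivX mwidenZ mwidenX.
rewrite mnmwiden_widen; congr (_ *: (_ *: 'X_[_]) + _).
apply/mnmP => j; rewrite mnmBE -mnmwiden1; case: (unliftP ord_max j) => [k ->|->].
  by rewrite lift_ord_max !mnmwiden_widen mnmBE.
by rewrite !mnmwiden_ordmax.
Qed.

Lemma mderiv_mwiden_max p : (mwiden p)^`M(ord_max) = 0.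
Proof.
elim/mpolyind: p => [|c m p _ _ IH]; first by rewrite raddf0 mderiv0.
by rewrite mwidenD mderivD mwidenZ mderivZ IH mwidenX mderivX mnmwiden_ordmax scale0r scaler0 addr0.
Qed.

Lemma mderivXU (i j : 'I_n) : ('X_i : {mpoly K[n]})^`M(j) = (i == j)%:R.
Proof.
rewrite mderivX mnm1E; case: eqVneq => [->|]; last by rewrite scale0r.
by rewrite scale1r (_ : (U_(j) - U_(j))%MM = 0%MM) ?mpolyX0 //; apply/mnmP => l; rewrite mnmBE subnn mnm0E.
Qed.

Lemma meval_mderivM (i : 'I_n) p q v :
  ((p * q)^`M(i)).@[v] = (p^`M(i)).@[v] * q.@[v] + p.@[v] * (q^`M(i)).@[v].
Proof. by rewrite mderivM mevalD !mevalM. Qed.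

End Widen.

Lemma comp_mpoly_homog (K : fieldType) n k d (t : n.-tuple {mpoly K[k]}) (p : {mpoly K[n]}) :
  (forall i, tnth t i \is 1.-homog) -> p \is d.-homog -> p \mPo t \is d.-homog.
Proof.
move=> th pd; rewrite comp_mpolyEX big_seq; apply: rpred_sum => m mp.
apply: rpredZ; rewrite comp_mpolyX -(dhomog_mf pd mp) /= mdegE.
apply: (big_ind2 (fun q e => q \is e.-homog)) => [|p1 d1 p2 d2|i _]; first exact: dhomog1.
  exact: dhomogM.
by have := dhomogMn (m i) (th i); rewrite mul1n.
Qed.

(** Multiplicative induction, suited to statements about ring morphisms and
    derivations, for which induction on monomials is awkward. *)
Lemma mpoly_ring_ind (K : fieldType) n (P : {mpoly K[n]} -> Prop) :
  (forall c, P c%:MP) -> (forall i, P 'X_i) ->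
  (forall p q, P p -> P q -> P (p + q)) -> (forall p q, P p -> P q -> P (p * q)) ->
  forall p, P p.
Proof.
move=> PC PX PD PM; elim/mpolyind => [|c m p _ _ IH]; first by rewrite -mpolyC0.
apply: (PD) => //; rewrite -mul_mpolyC; apply: (PM) => //; rewrite mpolyXE_id.
apply: (big_ind P); [by rewrite -mpolyC1|exact: PM|move=> i _].
by elim: (m i) => [|k IHk]; rewrite ?expr0 -?mpolyC1 // exprS; apply: PM.
Qed.

Lemma mderiv_comp (K : fieldType) n k (t : n.-tuple {mpoly K[k]}) (p : {mpoly K[n]}) j :
  (p \mPo t)^`M(j) = \sum_i (p^`M(i) \mPo t) * (tnth t i)^`M(j).
Proof.
elim/mpoly_ring_ind: p => [c|i|p q IHp IHq|p q IHp IHq].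
- rewrite comp_mpolyC mderivC big1 // => i _.
  by rewrite mderivC -mpolyC0 comp_mpolyC mpolyC0 mul0r.
- rewrite comp_mpolyXU (bigD1 i) //= mderivXU eqxx big1 ?addr0 => [|l li].
    by rewrite comp_mpoly1 mul1r (tnth_nth 0).
  by rewrite mderivXU eq_sym (negPf li) comp_mpoly0 mul0r.
- rewrite comp_mpolyD mderivD IHp IHq -big_split; apply: eq_bigr => i _ /=.
  by rewrite mderivD comp_mpolyD mulrDl.
- rewrite rmorphM mderivM IHp IHq mulr_suml mulr_sumr -big_split; apply: eq_bigr => i _ /=.
  by rewrite mderivM comp_mpolyD !rmorphM /= mulrDl; ring.
Qed.

Section Homog.
Variables (n : nat) (K : fieldType).
Implicit Types (g p c : {mpoly K[n]}).

Lemma dhomog_cofactor m k g c : g \is m.-homog -> g != 0 -> g * c \is (m + k).-homog ->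
  c != 0 -> c \is k.-homog.
Proof.
move=> gm g0 gc c0; have gc0 : g * c != 0 by rewrite mulf_neq0.
have := dhomog_factor (a := c) (b := g); rewrite mulrC => /(_ _ gc gc0) ch.
by have := dhomog_uniq gc0 gc (dhomogM gm ch) => /eqP; rewrite eqn_add2l => /eqP ->.
Qed.

Lemma rdvd_homog m k g p : g \is m.-homog -> p \is (m + k).-homog -> rdvd g p ->
  exists2 c, c \is k.-homog & p = g * c.
Proof.
move=> gm pd [c pc]; rewrite pc in pd *; have [g0|g0] := eqVneq g 0.
  by exists 0; rewrite ?g0 ?mul0r // rpred0.
have [->|c0] := eqVneq c 0; first by exists 0; rewrite // rpred0.
by exists c => //; exact: (dhomog_cofactor gm g0 pd c0).
Qed.

Lemma rdvd_exp p q k : irreducible p -> rdvd p (q ^+ k) -> rdvd p q.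
Proof.
move=> pirr; elim: k => [[c]|k IH]; last by rewrite exprS => /(prime_dvdM pirr)[].
rewrite expr0 => /esym pc; case: pirr => _ /negP[].
by apply/unitrP; exists c; rewrite mulrC pc.
Qed.

Lemma rdvd_small d e p q : p \is d.-homog -> q \is e.-homog -> (e < d)%N ->
  rdvd p q -> q = 0.
Proof.
move=> pd qe ed pq; apply/eqP/negPn/negP => q0.
have p0 : p != 0 by apply: contraNneq q0 => p0; case: pq => c ->; rewrite p0 mul0r.
have := rdvd_msize pq q0; rewrite (dhomog_msizeE pd p0) (dhomog_msizeE qe q0).
by rewrite leqNgt ltnS ed.
Qed.

Lemma mpoly_pchar2 : 2%N \in [pchar K] -> 2%N \in [pchar {mpoly K[n]}].
Proof. by move=> charK; rewrite inE /= -mpolyC_nat (pcharf0 charK) mpolyC0 eqxx. Qed.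

End Homog.

Section DirectionalDerivative.
Variables (n : nat) (K : fieldType).
Implicit Types (p q : {mpoly K[n]}) (u v : 'I_n -> K).

Definition dirderiv u p : {mpoly K[n]} := \sum_i u i *: p^`M(i).

Fact dirderiv_is_linear u : linear (dirderiv u).
Proof.
move=> c p q; rewrite /dirderiv scaler_sumr -big_split; apply: eq_bigr => i _ /=.
by rewrite mderivD mderivZ scalerDr !scalerA mulrC.
Qed.
HB.instance Definition _ u := GRing.isLinear.Build K {mpoly K[n]} {mpoly K[n]} _ (dirderiv u)
  (dirderiv_is_linear u).

Lemma dirderivM u p q : dirderiv u (p * q) = dirderiv u p * q + p * dirderiv u q.
Proof.
rewrite /dirderiv mulr_suml mulr_sumr -big_split; apply: eq_bigr => i _ /=.
by rewrite mderivM scalerDr scalerAl scalerAr.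
Qed.

Lemma meval_dirderivM_zero u v p q : p.@[v] = 0 -> (dirderiv u p).@[v] = 0 ->
  (dirderiv u (p * q)).@[v] = 0.
Proof. by move=> p0 dp0; rewrite dirderivM mevalD !mevalM p0 dp0 !mul0r addr0. Qed.

Hypothesis charK : 2%N \in [pchar K].

Lemma dirderiv_sqr u p : dirderiv u (p ^+ 2) = 0.
Proof.
by rewrite expr2 dirderivM mulrC (addrr_pchar2 (mpoly_pchar2 n charK)).
Qed.

End DirectionalDerivative.

(** * A Bezout bound for tangential intersections of plane curves *)

Section LinearForms.
Variables (n : nat) (K : fieldType).
Implicit Types (x y : 'rV[K]_n).

Definition minor x y (i j : 'I_n) : K := x 0 i * y 0 j - x 0 j * y 0 i.

Lemma minor_neq0 x y : x != 0 -> (forall c, y != c *: x) -> exists i j, minor x y i j != 0.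
Proof.
move=> /rV0Pn[i xi] nprop; exists i.
apply: NNPP => h; have /negP[] := nprop (y 0 i / x 0 i); apply/eqP/rowP => j.
rewrite mxE; apply: (mulfI xi).
have /negP : ~ minor x y i j != 0 by move=> hj; apply: h; exists j.
rewrite negbK subr_eq0 => /eqP ->; rewrite mulrA mulrCA mulrA.
by rewrite -mulrA [_ * y 0 i]mulrC -!mulrA mulVKf // mulrC.
Qed.

Lemma linear_form_homog (a b : K) (i j : 'I_n) : a *: 'X_i + b *: 'X_j \is 1.-homog.
Proof. by apply: rpredD; apply: rpredZ; rewrite dhomogX /= mdeg1. Qed.

Lemma exists_linear_form x y : x != 0 -> (forall c, y != c *: x) ->
  exists l : {mpoly K[n]}, [/\ l \is 1.-homog, l.@[x 0] = 0 & l.@[y 0] != 0].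
Proof.
move=> x0 /(minor_neq0 x0) [i [j mij]].
exists (x 0 i *: 'X_j + (- x 0 j) *: 'X_i); split; first exact: linear_form_homog.
  by rewrite mevalD !mevalZ !mevalXU mulNr mulrC subrr.
by rewrite mevalD !mevalZ !mevalXU mulNr.
Qed.

Lemma exists_separating_form D x s : x != 0 -> (size s <= D)%N ->
  (forall y, y \in s -> y != 0 /\ forall c, x != c *: y) ->
  exists q : {mpoly K[n]}, [/\ q \is D.-homog, q.@[x 0] != 0 &
    forall y, y \in s -> q.@[y 0] = 0].
Proof.
move=> x0; elim: D s => [|D IH] s.
  rewrite leqn0 size_eq0 => /eqP -> _; exists 1; split=> //; first exact: dhomog1.
  by rewrite meval1 oner_eq0.
move=> sD hs; have [q [qD qx qs]] : exists q : {mpoly K[n]}, [/\ q \is D.-homog, q.@[x 0] != 0 &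
    forall y, y \in behead s -> q.@[y 0] = 0].
  apply: IH => [|y ys]; first by rewrite size_behead; case: (size s) sD.
  by apply: hs; apply: mem_behead.
have [l [l1 lx ls]] : exists l : {mpoly K[n]}, [/\ l \is 1.-homog, l.@[x 0] != 0 &
    forall y, y \in take 1 s -> l.@[y 0] = 0].
  case: s hs {sD qs} => [|y s] hs.
    have /rV0Pn [i xi] := x0; exists ('X_i); split=> //; last by rewrite mevalXU.
    by rewrite dhomogX /= mdeg1.
  have [|y0 yx] := hs y; first exact: mem_head.
  have [l [h1 h2 h3]] := exists_linear_form y0 yx; exists l; split=> // z.
  by rewrite /= take0 inE => /eqP ->.
exists (l * q); split; first by rewrite -add1n; apply: dhomogM.
  by rewrite mevalM mulf_neq0.
case: s ls qs {hs sD} => [|y s] //= ls qs z; rewrite inE mevalM.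
by case/orP => [/eqP ->|/qs ->]; rewrite ?mulr0 // ls ?mul0r // take0 mem_head.
Qed.

End LinearForms.

(** In the application the image of phi is a graded piece of the ideal (g, W),
    kappa gives the Koszul syzygies, and psi evaluates forms at points. *)
Lemma codim_bound (K : fieldType) (C A B E : vectType K)
    (kappa : 'Hom(C, A)) (phi : 'Hom(A, B)) (psi : 'Hom(B, E)) :
  (lker phi <= limg kappa)%VS -> (forall v, psi (phi v) = 0) ->
  (forall w, exists v, psi v = w) -> (dim E + dim A <= dim B + dim C)%N.
Proof.
move=> ker0 comp0 surj.
have := limg_ker_dim psi fullv; have := limg_ker_dim phi fullv.
have := limg_ker_dim kappa fullv; rewrite !capfv !dimvf.
have -> : (psi @: fullv = fullv)%VS.
  apply/eqP; rewrite eqEsubv subvf; apply/subvP => w _; have [v <-] := surj w.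
  by apply: memv_img; apply: memvf.
rewrite dimvf; have h1 := dimvS ker0.
have : (phi @: fullv <= lker psi)%VS.
  by apply/subvP => w /memv_imgP [v _ ->]; rewrite memv_ker comp0.
move/dimvS; move: h1; lia.
Qed.

(** The dimension of a graded piece of K[x1, x2, x3] / (g, W) in high degree
    is the product of the degrees of g and W. *)
Lemma hilbert_function_count m n e N dA dB dC dD :
  (2 * dA = (n + e + 2) * (n + e + 1))%N -> (2 * dB = (m + e + 2) * (m + e + 1))%N ->
  (2 * dC = (e + 2) * (e + 1))%N ->
  (2 * dD = (m + (n + e) + 2) * (m + (n + e) + 1))%N ->
  (N * 2 + (dA + dB) <= dD + dC)%N -> (2 * N <= m * n)%N.
Proof. lia. Qed.

Section Bezout.
Variables (K : fieldType).
Hypothesis charK : 2%N \in [pchar K].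

Lemma dim_dhomog3 d : (2 * dim (dhomog 3 K d) = (d + 2) * (d + 1))%N.
Proof.
rewrite (_ : dim (dhomog 3 K d) = 'C(d + 2, d)) //.
have := bin_ffact (d + 2) 2; rewrite -(bin_sub (leq_addl d 2)) addnK => h.
by rewrite mulnC (_ : 2 = 2`!)%N // h !ffactnS ffactn0 muln1 addn2 addn1.
Qed.


Section DoubleBezout.
Variables (m n N : nat) (g W : {mpoly K[3]}) (x u : 'I_N -> 'rV[K]_3).
Hypotheses (g_homog : g \is m.-homog) (W_homog : W \is n.-homog).
Hypotheses (g_irr : irreducible g) (gW : ~ rdvd g W).
Hypotheses (x_neq0 : forall i, x i != 0)
  (x_distinct : forall i j, i != j -> forall c, x i != c *: x j)
  (u_indep : forall i c, u i != c *: x i).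
Hypotheses (gx : forall i, g.@[x i 0] = 0) (Wx : forall i, W.@[x i 0] = 0).
Hypotheses (dgx : forall i, (dirderiv (u i 0) g).@[x i 0] = 0)
  (dWx : forall i, (dirderiv (u i 0) W).@[x i 0] = 0).

(* The forms of degree d must separate the points; d is odd, so that they can
   be taken of the shape q^2 h with h linear. *)
Let e := (m + n + (N + N)).+1.
Let d := (m + (n + e))%N.

Let phi_fun (ab : dhomog 3 K (n + e) * dhomog 3 K (m + e)) : dhomog 3 K d :=
  indhomog d (g * ab.1 + W * ab.2).
Let psi_fun (f : dhomog 3 K d) : 'M[K]_(N, 2) :=
  \matrix_(i, j) if j == 0 then (f : {mpoly K[3]}).@[x i 0]
                 else (dirderiv (u i 0) f).@[x i 0].
Let kappa_fun (c : dhomog 3 K e) : dhomog 3 K (n + e) * dhomog 3 K (m + e) :=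
  (indhomog (n + e) (W * c), indhomog (m + e) (- (g * c))).

Let indhomogE k (p : {mpoly K[3]}) : p \is k.-homog -> (indhomog k p : {mpoly K[3]}) = p.
Proof. by move=> pk; rewrite /indhomog val_insubd pk. Qed.

Let dlin k c (p q : dhomog 3 K k) :
  (c *: p + q : dhomog 3 K k) = c *: (p : {mpoly K[3]}) + q :> {mpoly K[3]}.
Proof. exact: (linearP (@mpoly_of_dhomog 3 K k)). Qed.

Let dinj k (p q : dhomog 3 K k) : p = q :> {mpoly K[3]} -> p = q.
Proof. exact: val_inj. Qed.

Let phi_funE ab : (phi_fun ab : {mpoly K[3]}) = g * ab.1 + W * ab.2.
Proof.
apply: indhomogE; apply: rpredD; first exact/dhomogM/dhomog_is_dhomog.
by rewrite /d addnCA; apply/dhomogM/dhomog_is_dhomog.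
Qed.

Let phi_linear : linear phi_fun.
Proof.
move=> c a b; apply: dinj; rewrite dlin !phi_funE.
have -> : ((c *: a + b).1 : {mpoly K[3]}) = c *: (a.1 : {mpoly K[3]}) + b.1 by exact: dlin.
have -> : ((c *: a + b).2 : {mpoly K[3]}) = c *: (a.2 : {mpoly K[3]}) + b.2 by exact: dlin.
by rewrite !mulrDr !scalerDr !scalerAr addrACA.
Qed.

Let kappa_funE c : ((kappa_fun c).1 = W * c :> {mpoly K[3]}) /\
  ((kappa_fun c).2 = - (g * c) :> {mpoly K[3]}).
Proof.
by rewrite /kappa_fun /= !indhomogE ?rpredN //; apply/dhomogM/dhomog_is_dhomog.
Qed.

Let kappa_linear : linear kappa_fun.
Proof.
move=> c a b; have [h1 h2] := kappa_funE (c *: a + b).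
have [h3 h4] := kappa_funE a; have [h5 h6] := kappa_funE b.
apply: injective_projections; apply: dinj.
  have -> : ((c *: kappa_fun a + kappa_fun b).1 : {mpoly K[3]}) =
    c *: ((kappa_fun a).1 : {mpoly K[3]}) + (kappa_fun b).1 by exact: dlin.
  by rewrite h1 dlin h3 h5 mulrDr scalerAr.
have -> : ((c *: kappa_fun a + kappa_fun b).2 : {mpoly K[3]}) =
    c *: ((kappa_fun a).2 : {mpoly K[3]}) + (kappa_fun b).2 by exact: dlin.
by rewrite h2 dlin h4 h6 mulrDr scalerN scalerAr opprD.
Qed.

Let psi_linear : linear psi_fun.
Proof.
move=> c a b; apply/matrixP => i j; rewrite !mxE.
rewrite (dlin c a b).
by case: ifP => _; rewrite ?(linearP (dirderiv (u i 0))) mevalD mevalZ.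
Qed.


HB.instance Definition _ := GRing.isLinear.Build K _ _ _ phi_fun phi_linear.
HB.instance Definition _ := GRing.isLinear.Build K _ _ _ kappa_fun kappa_linear.
HB.instance Definition _ := GRing.isLinear.Build K _ _ _ psi_fun psi_linear.

Let psi_phi ab : psi_fun (phi_fun ab) = 0.
Proof.
apply/matrixP => i j; rewrite !mxE phi_funE; case: ifP => _.
  by rewrite mevalD !mevalM gx Wx !mul0r addr0.
by rewrite raddfD mevalD !meval_dirderivM_zero // addr0.
Qed.

Let ker_phi ab : phi_fun ab = 0 -> exists c, kappa_fun c = ab.
Proof.
move/(congr1 (@mpoly_of_dhomog 3 K d)); rewrite phi_funE /= => gW0.
have [g0 _ _] := g_irr.
have eq1 : W * ab.2 = g * - (ab.1 : {mpoly K[3]}).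
  by rewrite mulrN; apply/eqP; rewrite -addr_eq0 addrC gW0.
have [c ec] : rdvd g (ab.2 : {mpoly K[3]}).
  have : rdvd g (W * ab.2) by exists (- (ab.1 : {mpoly K[3]})).
  by case/(prime_dvdM g_irr).
have [c' c'e ec'] : exists2 c', c' \is e.-homog & ab.2 = g * c' :> {mpoly K[3]}.
  by apply: (rdvd_homog g_homog); [exact: dhomog_is_dhomog | exists c].
exists (indhomog e (- c')); have [h1 h2] := kappa_funE (indhomog e (- c')).
apply: injective_projections; apply: dinj.
  rewrite h1 indhomogE ?rpredN //; apply: (mulfI g0).
  by rewrite -[RHS]opprK -[- (g * _)]mulrN -eq1 ec' mulrN mulrN mulrCA.
by rewrite h2 indhomogE ?rpredN // mulrN opprK.
Qed.

Let linear_meval (h : {mpoly K[3]}) i j (a b : K) : h = a *: 'X_i + b *: 'X_j ->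
  forall v w : 'rV[K]_3, (dirderiv (w 0) h).@[v 0] = h.@[w 0].
Proof.
move=> -> v w; rewrite linearP linearZ /= mevalD !mevalZ mevalD !mevalZ !mevalXU.
have dX k : (dirderiv (w 0) 'X_k).@[v 0] = w 0 k.
  rewrite /dirderiv raddf_sum /= (bigD1 k) //= mderivXU eqxx mevalZ meval1 mulr1.
  rewrite big1 ?addr0 // => l /negPf lk.
  by rewrite mderivXU eq_sym lk scaler0 meval0.
by rewrite !dX.
Qed.

Let exists_dual_linear i : exists2 h : {mpoly K[3]} * {mpoly K[3]},
  [/\ h.1 \is 1.-homog, h.1.@[x i 0] = 1 & (dirderiv (u i 0) h.1).@[x i 0] = 0] &
  [/\ h.2 \is 1.-homog, h.2.@[x i 0] = 0 & (dirderiv (u i 0) h.2).@[x i 0] = 1].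
Proof.
have [a [b mab]] := minor_neq0 (x_neq0 i) (u_indep i).
set M := minor _ _ _ _ in mab.
exists ((u i 0 b / M) *: 'X_a + (- u i 0 a / M) *: 'X_b,
        (- x i 0 b / M) *: 'X_a + (x i 0 a / M) *: 'X_b) => /=; split;
  rewrite ?linear_form_homog ?(linear_meval erefl) //;
  rewrite mevalD !mevalZ !mevalXU; rewrite /M /minor in mab *; field; exact: mab.
Qed.

(* The forms q^2 h, with q vanishing at all points but x i: the derivative of
   q^2 is zero, so the values and derivatives are those of h up to a factor. *)
Let psi_surj w : exists f, psi_fun f = w.
Proof.
pose basis_like i (f : dhomog 3 K d * dhomog 3 K d) :=
  psi_fun f.1 = delta_mx i 0 /\ psi_fun f.2 = delta_mx i 1.
have ex_basis i : exists f, basis_like i f.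
  pose s := [seq x j | j <- enum 'I_N & j != i].
  have ss : (size s <= m + n + N)%N.
    rewrite size_map size_filter; apply: leq_trans (count_size _ _) _.
    by rewrite size_enum_ord leq_addl.
  have [|q [q1 q2 q3]] := exists_separating_form (x_neq0 i) ss.
    move=> y /mapP[j]; rewrite mem_filter => /andP[ji _] ->.
    by split=> // c; apply: x_distinct; rewrite eq_sym.
  have sqr_homog (h : {mpoly K[3]}) : h \is 1.-homog -> q ^+ 2 * h \is d.-homog.
    move=> h1; rewrite (_ : d = (m + n + N) * 2 + 1)%N; first exact/dhomogM/h1/dhomogMn.
    by rewrite /d /e; lia.
  have [[h1 h2] /= [a1 a2 a3] [b1 b2 b3]] := exists_dual_linear i.
  have qh k (h : {mpoly K[3]}) : (q ^+ 2 * h).@[x k 0] = q.@[x k 0] ^+ 2 * h.@[x k 0].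
    by rewrite mevalM rmorphXn.
  have dqh k (h : {mpoly K[3]}) : (dirderiv (u k 0) (q ^+ 2 * h)).@[x k 0] =
      q.@[x k 0] ^+ 2 * (dirderiv (u k 0) h).@[x k 0].
    by rewrite dirderivM dirderiv_sqr // mul0r add0r mevalM rmorphXn.
  have qk k : k != i -> q.@[x k 0] = 0.
    by move=> ki; apply: q3; apply: map_f; rewrite mem_filter ki mem_enum.
  set c := q.@[x i 0] in q2; pose c2 := (c ^+ 2)^-1.
  have c20 : c2 * c ^+ 2 = 1 by rewrite mulVf // expf_neq0.
  exists (c2 *: indhomog d (q ^+ 2 * h1), c2 *: indhomog d (q ^+ 2 * h2)).
  split; rewrite /= linearZ /=; apply/matrixP => k j;
    rewrite !mxE !indhomogE ?sqr_homog // qh dqh;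
    (have [->|/qk ->] := eqVneq k i; last by rewrite expr0n !mul0r; case: ifP; rewrite mulr0);
    case: j => [[|[]]] //= ?; rewrite ?(a2, a3, b2, b3) -/c ?mulr1 ?mulr0 //.
have [f fP] : exists f, forall i, basis_like i (f i).
  have /fin_all_exists [f hf] := ex_basis; by exists f.
exists (\sum_i (w i 0 *: (f i).1 + w i 1 *: (f i).2)).
rewrite linear_sum [RHS]matrix_sum_delta; apply: eq_bigr => i _ /=.
have [h1 h2] := fP i; rewrite linearD !linearZ /= h1 h2.
rewrite !big_ord_recl big_ord0 addr0.
by have -> : lift ord0 ord0 = 1 :> 'I_2 by exact: val_inj.
Qed.

(** The values at the x i and the derivatives along the u i are 2 N independent
    linear functionals on forms of degree d which vanish on the ideal (g, W),
    while that ideal has codimension at most m n in degree d. *)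
Theorem double_bezout : (2 * N <= m * n)%N.
Proof.
have ker0 : (lker (linfun phi_fun) <= limg (linfun kappa_fun))%VS.
  apply/subvP => ab; rewrite memv_ker lfunE /= => /eqP /ker_phi [c <-].
  by rewrite -(lfunE kappa_fun) memv_img // memvf.
have comp0 ab : linfun psi_fun (linfun phi_fun ab) = 0.
  by rewrite !lfunE /= psi_phi.
have surj w : exists f, linfun psi_fun f = w.
  by have [f <-] := psi_surj w; exists f; rewrite lfunE.
have := codim_bound ker0 comp0 surj.
rewrite dim_matrix (_ : dim _ = dim (dhomog 3 K (n + e)) + dim (dhomog 3 K (m + e)))%N //.
have := dim_dhomog3 (n + e); have := dim_dhomog3 (m + e).
have := dim_dhomog3 d; have := dim_dhomog3 e; rewrite {1}/d => hC hD hB hA.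
exact: hilbert_function_count hA hB hC hD.
Qed.

End DoubleBezout.
End Bezout.

Section Normalize.
Variables (K : fieldType) (n : nat).
Implicit Types x y : 'rV[K]_n.

(** Representatives of points of projective space: proportional vectors have
    the same normalization. *)
Definition normalize x : 'rV[K]_n :=
  if [pick i | x 0 i != 0] is Some i then (x 0 i)^-1 *: x else x.

Definition normalized x : bool := (x != 0) && (normalize x == x).

Lemma normalizeE x : x != 0 -> exists2 c, c != 0 & normalize x = c *: x.
Proof.
move=> /rV0Pn [j xj]; rewrite /normalize; case: pickP => [i xi|/(_ j)]; last by rewrite xj.
by exists (x 0 i)^-1; rewrite ?invr_eq0.
Qed.

Lemma normalize_scale c x : c != 0 -> normalize (c *: x) = normalize x.
Proof.
move=> c0; rewrite /normalize (@eq_pick _ _ (fun i => x 0 i != 0)) => [|i]; last first.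
  by rewrite /= mxE mulf_eq0 (negPf c0).
case: pickP => [i xi|x0]; first by rewrite mxE scalerA invfM mulrAC mulVf // mul1r.
by apply/rowP => i; rewrite mxE; have := x0 i; rewrite /= => /negbFE /eqP ->; rewrite mulr0.
Qed.

Lemma normalized_neq_scale x y c : normalized x -> normalized y -> x != y -> x != c *: y.
Proof.
move=> /andP[x0 /eqP nx] /andP[y0 /eqP ny]; apply: contraNneq => xy.
have c0 : c != 0 by apply: contraNneq x0 => c0; rewrite xy c0 scale0r.
have : normalize x = normalize y by rewrite xy normalize_scale.
by rewrite nx ny => ->.
Qed.

End Normalize.

Section Tangent.
Variable K : fieldType.

(** The kernel of the gradient has dimension at least 2. *)
Lemma exists_tangent (g : {mpoly K[3]}) (x : 'rV[K]_3) :
  exists u : 'rV[K]_3, (dirderiv (u 0) g).@[x 0] = 0 /\ forall c, u != c *: x.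
Proof.
pose gam : 'cV[K]_3 := \col_i (g^`M(i)).@[x 0].
have : ~~ (kermx gam <= x)%MS.
  apply/negP => /mxrankS; rewrite mxrank_ker => h.
  have := leq_trans h (rank_leq_row x); have := rank_leq_col gam.
  by case: (\rank gam) => [|[|]].
case/row_subPn => i hi; exists (row i (kermx gam)); split; last first.
  by move=> c; apply: contraNneq hi => ->; apply: scalemx_sub.
have /sub_kermxP : (row i (kermx gam) <= kermx gam)%MS by apply: row_sub.
move/matrixP => /(_ 0 0); rewrite !mxE => e; rewrite -[RHS]e.
rewrite /dirderiv raddf_sum /=; apply: eq_bigr => j _.
by rewrite mevalZ [gam _ _]mxE.
Qed.

Hypothesis charK : 2%N \in [pchar K].

Lemma bezout_tangent m n (g W : {mpoly K[3]}) (xs : seq 'rV[K]_3) :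
  g \is m.-homog -> W \is n.-homog -> irreducible g -> ~ rdvd g W ->
  uniq xs -> (forall x, x \in xs -> [/\ normalized x, g.@[x 0] = 0, W.@[x 0] = 0 &
    forall u, (dirderiv u g).@[x 0] = 0 -> (dirderiv u W).@[x 0] = 0]) ->
  (2 * size xs <= m * n)%N.
Proof.
move=> gm Wn girr gW uxs hxs; pose x (i : 'I_(size xs)) := nth 0 xs i.
have xi i : x i \in xs by apply: mem_nth.
have /fin_all_exists [u hu] i := exists_tangent g (x i).
apply: (double_bezout charK gm Wn girr gW (x := x) (u := u)).
- by move=> i; have [/andP[]] := hxs _ (xi i).
- move=> i j ij c; have [ni _ _ _] := hxs _ (xi i); have [nj _ _ _] := hxs _ (xi j).
  by apply: normalized_neq_scale => //; rewrite nth_uniq.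
- by move=> i; have [] := hu i.
- by move=> i; have [] := hxs _ (xi i).
- by move=> i; have [] := hxs _ (xi i).
- by move=> i; have [] := hu i.
- by move=> i; have [_ _ _] := hxs _ (xi i); apply; have [] := hu i.
Qed.

(** The square of W has zero derivative in every direction, so the bound for
    tangential intersections applies to it and yields the usual one for W. *)
Lemma bezout_points m n (g W : {mpoly K[3]}) (xs : seq 'rV[K]_3) :
  g \is m.-homog -> W \is n.-homog -> irreducible g -> ~ rdvd g W ->
  uniq xs -> (forall x, x \in xs -> [/\ normalized x, g.@[x 0] = 0 & W.@[x 0] = 0]) ->
  (size xs <= m * n)%N.
Proof.
move=> gm Wn girr gW uxs hxs; rewrite -(leq_pmul2l (isT : 0 < 2)%N).
have -> : (2 * (m * n) = m * (n * 2))%N by rewrite mulnC -mulnA.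
apply: (bezout_tangent gm (dhomogMn 2 Wn) girr _ uxs) => [/(rdvd_exp girr)//|y /hxs [h1 h2 h3]].
by split=> // [|u _]; rewrite ?dirderiv_sqr ?meval0 // rmorphXn /= h3 expr0n.
Qed.

End Tangent.

(** * Non-normality from an integral fraction over a branch curve *)

Section NonNormal.
Variable K : fieldType.
Hypothesis charK : 2%N \in [pchar K].
Variables (Q G B : {mpoly K[3]}).
Hypotheses (Q2 : Q \is 2.-homog) (G3 : G \is 3.-homog) (B4 : B \is 4.-homog).
Local Notation z := ('X_ord_max : {mpoly K[4]}).
(** The equation of the surface, with the centre P at x = 0, z = 1. *)
Definition taylor_form : {mpoly K[4]} := z ^+ 2 * mwiden Q + z * mwiden G + mwiden B.
Local Notation F := taylor_form.

Definition cone_point (x : 'I_3 -> K) (t : K) : 'rV[K]_4 := \row_i extend_point x t i.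

Lemma cone_point_max x t : cone_point x t 0 ord_max = t.
Proof. by rewrite mxE /extend_point unlift_none. Qed.

Lemma cone_point_widen x t i : cone_point x t 0 (widen_ord (leqnSn 3) i) = x i.
Proof.
by rewrite mxE /extend_point -lift_ord_max liftK.
Qed.

Lemma meval_mwiden_cone x t (p : {mpoly K[3]}) : (mwiden p).@[cone_point x t 0] = p.@[x].
Proof. by rewrite meval_mwiden; apply: meval_eq => i; rewrite cone_point_widen. Qed.

Lemma meval_taylor x t : F.@[cone_point x t 0] = t ^+ 2 * Q.@[x] + t * G.@[x] + B.@[x].
Proof.
by rewrite /F !mevalD !mevalM !meval_mwiden_cone mevalXU cone_point_max expr2.
Qed.

Lemma taylor_form_homog : F \is 4.-homog.
Proof.
have z1 : z \is 1.-homog by rewrite dhomogX /= mdeg1.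
rewrite /F; apply: rpredD; last exact: mwiden_homog.
apply: rpredD; last by apply: (dhomogM (d := 1) (e := 3)) => //; apply: mwiden_homog.
by apply: (dhomogM (d := 2) (e := 2)); [apply: (dhomogMn 2 z1) | apply: mwiden_homog].
Qed.

Lemma mderiv_taylor_max : F^`M(ord_max) = mwiden G.
Proof.
rewrite /F !mderivD !mderivM !mderiv_mwiden_max !mderivXU eqxx !mulr0 !addr0 !(mul1r, mulr1).
by rewrite (addrr_pchar2 (mpoly_pchar2 4 charK)) mul0r add0r.
Qed.

(** With u = z a + b one has Q u^2 + a G u + (a b G + a^2 B + b^2 Q) = a^2 F in
    characteristic 2, so that u / g is integral over the points where Q is not
    zero. If u / g were equal to C / D near the point over x with u = g = 0,
    the derivative in z of u D - g C, a multiple of F, would be a D there; but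
    F and dF/dz = G vanish at that point, and a D does not. *)
Lemma not_normal_of_integral_fraction dg da (g a b : {mpoly K[3]}) (x : 'I_3 -> K) :
  g \is dg.-homog -> a \is da.-homog -> b \is da.+1.-homog ->
  (dg < 4)%N -> (dg <= da.+1)%N -> g != 0 ->
  rdvd g G -> rdvd (g ^+ 2) (a * b * G + a ^+ 2 * B + b ^+ 2 * Q) ->
  g.@[x] = 0 -> Q.@[x] != 0 -> a.@[x] != 0 -> ~ normal_surface F.
Proof.
move=> gd ad bd dg4 dga g0 gG g2N gx Qx ax [Firr Fnormal].
have char4 := mpoly_pchar2 4 charK.
have dbl (p : {mpoly K[4]}) : p + p = 0 := addrr_pchar2 char4 p.
have [r rd Gr] : exists2 r, r \is (3 - dg).-homog & G = g * r.
  by apply: (rdvd_homog (m := dg)) gG => //; rewrite subnKC.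
set N := a * b * G + _ + _ in g2N.
have [N' N'd NN'] : exists2 N', N' \is (2 * da + 4 - 2 * dg).-homog & N = g ^+ 2 * N'.
  apply: (rdvd_homog (m := 2 * dg)) g2N; first by rewrite mulnC; apply: dhomogMn.
  rewrite subnKC; last by clear -dga; lia.
  rewrite /N; apply: rpredD; first apply: rpredD.
  - rewrite (_ : 2 * da + 4 = da + da.+1 + 3)%N; last by clear -dga; lia.
    by apply: dhomogM => //; apply: dhomogM.
  - by rewrite mulnC; apply: dhomogM => //; apply: dhomogMn.
  - rewrite (_ : 2 * da + 4 = da.+1 * 2 + 2)%N; last by clear -dga; lia.
    by apply: dhomogM => //; apply: dhomogMn.
(* The point of the surface over x at which z a + b vanishes. *)
pose t := b.@[x] / a.@[x]; pose p := cone_point x t.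
have ev q : (mwiden q).@[p 0] = q.@[x] by exact: meval_mwiden_cone.
have Fp : F.@[p 0] = 0.
  have : N.@[x] = 0 by rewrite NN' mevalM rmorphXn /= gx expr0n mul0r.
  rewrite /N meval_taylor !mevalD !mevalM /t => Nx0.
  apply: (mulfI (expf_neq0 2 ax)); rewrite mulr0 -[RHS]Nx0; field; exact: ax.
have p0 : p != 0.
  apply: contraNneq Qx => p0; have := ev Q; rewrite p0 => <-.
  by rewrite (meval_homog0 (mwiden_homog Q2)) // => i; rewrite mxE.
have /rV0Pn [i0 pi0] := p0.
(* A power of the linear form l makes u and the denominator forms of the same
   degree without changing anything near p. *)
pose l : {mpoly K[4]} := 'X_i0; pose e := (da.+1 - dg)%N.
have l1 : l \is 1.-homog by rewrite dhomogX /= mdeg1.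
have lp : l.@[p 0] != 0 by rewrite /l mevalXU.
have le1 : l ^+ e \is e.-homog by have := dhomogMn e l1; rewrite mul1n.
pose u := z * mwiden a + mwiden b; pose v := mwiden g * l ^+ e.
have z1 : z \is 1.-homog by rewrite dhomogX /= mdeg1.
have ud : u \is da.+1.-homog.
  by apply: rpredD; [apply: (dhomogM (d := 1) (e := da)) => //|]; apply: mwiden_homog.
have vd : v \is da.+1.-homog.
  have -> : da.+1 = (dg + e)%N by rewrite /e subnKC.
  by apply: dhomogM => //; apply: mwiden_homog.
have nFv : ~ divides F v.
  have Firr' : irreducible F by [].
  case/(prime_dvdM Firr') => [|/(rdvd_exp Firr')].
    move/(rdvd_small taylor_form_homog (mwiden_homog gd) dg4) => h.
    by move: g0; rewrite -(inj_eq (@inj_mwiden 3 K)) h mwiden0 eqxx.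
  move/(rdvd_small taylor_form_homog l1 isT) => h.
  by move: lp; rewrite h meval0 eqxx.
have up : u.@[p 0] = 0.
  rewrite /u mevalD mevalM !ev mevalXU cone_point_max /t divfK //.
  exact: addrr_pchar2 charK _.
have vp : v.@[p 0] = 0 by rewrite /v mevalM ev gx mul0r.
have [] := Fnormal p p0 Fp _ _ _ ud vd nFv.
  pose c (i : 'I_2) : {mpoly K[4]} := if i == 0 then mwiden N' else mwiden (a * r) * l ^+ e.
  exists 2%N, (2 + 2 * e)%N, c, (mwiden Q * l ^+ (2 * e)); split.
  - move=> i; rewrite /c; case: ifP => _.
      rewrite (_ : 2 + 2 * e = 2 * da + 4 - 2 * dg)%N; last by rewrite /e; clear -dga dg4; lia.
      exact: mwiden_homog.
    rewrite (_ : 2 + 2 * e = (da + (3 - dg)) + e)%N; last by rewrite /e; clear -dga dg4; lia.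
    by apply: dhomogM => //; apply: mwiden_homog; apply: dhomogM.
  - by apply: dhomogM; [apply: mwiden_homog | have := dhomogMn (2 * e) l1; rewrite mul1n].
  - by rewrite mevalM ev rmorphXn /= mulf_neq0 // expf_neq0.
  rewrite !big_ord_recl big_ord0 /= addr0 subn0 /c /=.
  exists (l ^+ (2 * e) * mwiden a ^+ 2).
  rewrite expr0 expr1 mulr1 /bump /= subSS subn0 expr1.
  have wN : mwiden g ^+ 2 * mwiden N' = mwiden N by rewrite NN' mwidenM rmorphXn.
  have wG : mwiden g * mwiden r = mwiden G by rewrite Gr mwidenM.
  transitivity (l ^+ (2 * e) * (mwiden Q * u ^+ 2 + mwiden a * (mwiden g * mwiden r) * u
                 + mwiden g ^+ 2 * mwiden N')).
    by rewrite /v mwidenM mulnC exprM; ring.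
  rewrite wN wG /N /u /F !(mwidenD, mwidenM).
  set a' := mwiden a; set b' := mwiden b; set Q' := mwiden Q; set G' := mwiden G; set B' := mwiden B.
  pose w := z * a' * b' * Q' + b' ^+ 2 * Q' + a' * b' * G'.
  transitivity ((z ^+ 2 * Q' + z * G' + B') * (l ^+ (2 * e) * a' ^+ 2) + l ^+ (2 * e) * (w + w)).
    by rewrite /w; ring.
  by rewrite dbl mulr0 addr0.
move=> k [C [D [Cd Dd Dp [H /(congr1 (fun q => (q^`M(ord_max)).@[p 0]))]]]].
rewrite mderivB mevalB (meval_mderivM _ u D) (meval_mderivM _ C v) meval_mderivM mderiv_taylor_max Fp up vp.
have -> : (mwiden G).@[p 0] = 0 by rewrite ev Gr mevalM gx mul0r.
rewrite !mul0r.
have -> : (u^`M(ord_max)).@[p 0] = a.@[x].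
  by rewrite /u mderivD mderivM !mderiv_mwiden_max mderivXU eqxx mul1r mulr0 !addr0 ev.
have -> : (v^`M(ord_max)).@[p 0] = 0.
  by rewrite /v mderivM mderiv_mwiden_max mul0r add0r mevalM ev gx mul0r.
rewrite !mulr0 !addr0 subr0 => /eqP.
by rewrite mulf_eq0 (negPf ax) (negPf Dp).
Qed.

End NonNormal.

(** * Non-normality along a line through the centre *)

(** The ratio t / r satisfies a quadratic equation whose leading coefficient
    A11 is invertible at P. If it were equal to C / D, then t D - r C would be
    a multiple of F, which is singular at P; its derivative along u is not
    zero there. *)
Lemma not_normal_of_quadratic_form (K : fieldType) (F A11 A12 A22 t r : {mpoly K[4]})
    (P : 'rV[K]_4) (u : 'I_4 -> K) :
  F = A11 * t ^+ 2 + A12 * t * r + A22 * r ^+ 2 ->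
  A11 \is 2.-homog -> A12 \is 2.-homog -> A22 \is 2.-homog ->
  t \is 1.-homog -> r \is 1.-homog -> P != 0 -> t.@[P 0] = 0 -> r.@[P 0] = 0 ->
  A11.@[P 0] != 0 -> (dirderiv u t).@[P 0] != 0 -> (dirderiv u r).@[P 0] = 0 ->
  ~ divides F r -> ~ normal_surface F.
Proof.
move=> FE h11 h12 h22 th rh P0 tP rP A11P dtP drP nFr [_ Fnormal].
have FP : F.@[P 0] = 0 by rewrite FE !mevalD !mevalM tP rP !(mulr0, mul0r) !addr0.
have dFP : (dirderiv u F).@[P 0] = 0.
  rewrite FE !raddfD /= !expr2 !dirderivM !mevalD !mevalM !mevalD !mevalM tP rP.
  by rewrite !(mulr0, mul0r, addr0).
have [] := Fnormal P P0 FP _ _ _ th rh nFr.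
  exists 2%N, 2%N, (fun i : 'I_2 => if i == 0 then A22 else A12), A11; split=> //.
    by move=> i; case: ifP.
  rewrite !big_ord_recl big_ord0 /= /bump /= !subn0 subSS subn0 expr0 !expr1 mulr1 addr0.
  by exists 1; rewrite mulr1 FE [A22 * _ + _]addrC addrA.
move=> k [C [D [_ _ DP [H /(congr1 (fun q => (dirderiv u q).@[P 0]))]]]].
rewrite raddfB /= mevalB !dirderivM !mevalD !mevalM tP rP drP FP dFP.
by rewrite !(mulr0, mul0r, addr0, subr0) => /eqP; rewrite mulf_eq0 (negPf dtP) (negPf DP).
Qed.

(** If the form has no square terms at P, the substitution of s + t for t
    produces one. *)
Lemma not_normal_of_binary_form (K : fieldType) (charK : 2%N \in [pchar K])
    (F A11 A12 A22 s t : {mpoly K[4]}) (P : 'rV[K]_4) (u v : 'I_4 -> K) (k : K) :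
  F \is 4.-homog -> F = A11 * s ^+ 2 + A12 * s * t + A22 * t ^+ 2 ->
  A11 \is 2.-homog -> A12 \is 2.-homog -> A22 \is 2.-homog ->
  s \is 1.-homog -> t \is 1.-homog -> P != 0 -> s.@[P 0] = 0 -> t.@[P 0] = 0 ->
  k != 0 -> (dirderiv u s).@[P 0] = k -> (dirderiv u t).@[P 0] = 0 ->
  (dirderiv v s).@[P 0] = 0 -> (dirderiv v t).@[P 0] = k ->
  [\/ A11.@[P 0] != 0, A12.@[P 0] != 0 | A22.@[P 0] != 0] -> ~ normal_surface F.
Proof.
move=> Fh FE h11 h12 h22 sh th P0 sP tP k0 us ut vs vt AP.
have small r w : r \is 1.-homog -> (dirderiv w r).@[P 0] != 0 -> ~ divides F r.
  move=> rh dr /(rdvd_small Fh rh isT) r0; move: dr.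
  by rewrite r0 raddf0 meval0 eqxx.
have [e11|e11] := eqVneq A11.@[P 0] 0; last first.
  apply: (not_normal_of_quadratic_form (P := P) (u := u) FE) => //; first by rewrite us.
  by apply: (small _ v) => //; rewrite vt.
have [e22|e22] := eqVneq A22.@[P 0] 0; last first.
  have FE' : F = A22 * t ^+ 2 + A12 * t * s + A11 * s ^+ 2 by rewrite FE; ring.
  apply: (not_normal_of_quadratic_form (P := P) (u := v) FE') => //; first by rewrite vt.
  by apply: (small _ u) => //; rewrite us.
have e12 : A12.@[P 0] != 0 by case: AP => //; rewrite ?e11 ?e22 eqxx.
have dbl (p : {mpoly K[4]}) : p + p = 0 := addrr_pchar2 (mpoly_pchar2 4 charK) p.
have FE' : F = (A11 + A12 + A22) * s ^+ 2 + A12 * s * (s + t) + A22 * (s + t) ^+ 2.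
  pose w := A12 * s ^+ 2 + A22 * s ^+ 2 + A22 * s * t.
  by rewrite FE -[LHS]addr0 -(dbl w) /w; ring.
have dirE (p : {mpoly K[4]}) : dirderiv (fun j => u j + v j) p = dirderiv u p + dirderiv v p.
  by rewrite /dirderiv -big_split; apply: eq_bigr => j _; rewrite scalerDl.
apply: (not_normal_of_quadratic_form (P := P) (u := fun j => u j + v j) FE') => //.
- by apply: rpredD => //; apply: rpredD.
- exact: rpredD.
- by rewrite mevalD sP tP addr0.
- by rewrite !mevalD e11 e22 add0r addr0.
- by rewrite dirE mevalD us vs addr0.
- rewrite dirE mevalD !raddfD /= us vs ut vt addr0 add0r.
  exact: addrr_pchar2 charK _.
- apply: (small _ u); first exact: rpredD.
  by rewrite raddfD /= mevalD us ut addr0.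
Qed.

Section Decomposition.
Variables (K : fieldType) (x : 'rV[K]_3) (c : 'I_3).
Hypothesis xc : x 0 c != 0.
Local Notation X i := ('X_i : {mpoly K[3]}).
(** For i other than c, these two linear forms generate the ideal of the point
    x, and together with X c they form a basis of the linear forms. *)
Definition vanishing_form (i : 'I_3) : {mpoly K[3]} := x 0 c *: X i - x 0 i *: X c.
Local Notation L := vanishing_form.
Local Notation a := (c + 1).
Local Notation b := (c + 2).

Let ord3_cases i : [\/ i = a, i = b | i = c].
Proof.
have all3 (j k : 'I_3) : (k == j + 1) || (k == j + 2) || (k == j).
  by case: j => [[|[|[]]]] //= ?; case: k => [[|[|[]]]] //= ?.
by have /orP[/orP[]|] := all3 c i => /eqP ->; [apply: Or31|apply: Or32|apply: Or33].
Qed.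

Lemma vanishing_form_homog i : L i \is 1.-homog.
Proof. by rewrite /L -scaleNr; apply: linear_form_homog. Qed.

Lemma meval_vanishing_form i : (L i).@[x 0] = 0.
Proof. by rewrite mevalB !mevalZ !mevalXU mulrC subrr. Qed.

Lemma mderiv_vanishing_form i j : j != c -> (L i)^`M(j) = (x 0 c * (i == j)%:R)%:MP.
Proof.
move=> jc; rewrite mderivB !mderivZ !mderivXU [c == j]eq_sym (negPf jc) scaler0 subr0.
by case: eqP; rewrite ?scaler0 ?mulr0 ?mulr1 ?mpolyC0 // alg_mpolyC.
Qed.

(** A Taylor development at the point x, up to terms of order two. *)
Definition second_order_split k (f : {mpoly K[3]}) : Prop :=
  exists (f11 f12 f22 : {mpoly K[3]}) (al be ga : K),
    [/\ f11 \is k.-homog, f12 \is k.-homog, f22 \is k.-homog &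
        f = f11 * L a ^+ 2 + f12 * L a * L b + f22 * L b ^+ 2
            + (al *: L a + be *: L b) * X c ^+ k.+1 + ga *: X c ^+ k.+2].

Let split_linear k e f g : second_order_split k f -> second_order_split k g ->
  second_order_split k (e *: f + g).
Proof.
case=> [f1 [f2 [f3 [a1 [a2 [a3 [h1 h2 h3 ->]]]]]]].
case=> [g1 [g2 [g3 [b1 [b2 [b3 [k1 k2 k3 ->]]]]]]].
exists (e *: f1 + g1), (e *: f2 + g2), (e *: f3 + g3), (e * a1 + b1), (e * a2 + b2), (e * a3 + b3).
split; try by apply: rpredD => //; apply: rpredZ.
by rewrite -!mul_mpolyC !(mpolyCD, mpolyCM); ring.
Qed.

Let var_split i : exists p q s : K, X i = p *: L a + q *: L b + s *: X c.
Proof.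
have main : X i = (x 0 c)^-1 *: L i + (x 0 i / x 0 c) *: X c.
  rewrite /L scalerBr !scalerA mulVf // scale1r [x 0 i / _]mulrC.
  by rewrite subrK.
case: (ord3_cases i) => e; rewrite {1}e.
- exists (x 0 c)^-1, 0, (x 0 i / x 0 c); rewrite scale0r addr0 -e; exact: main.
- exists 0, (x 0 c)^-1, (x 0 i / x 0 c); rewrite scale0r add0r -e; exact: main.
- by exists 0, 0, 1; rewrite !scale0r !add0r scale1r.
Qed.

Let split_monomial k m : mdeg m = k.+2 -> second_order_split k 'X_[m].
Proof.
elim: k m => [|k IH] m.
  move=> /(mpolyX_split K) [i [m1 [/(mpolyX_split K) [j [m0 [/eqP]]]]]].
  rewrite mdeg_eq0 => /eqP -> -> ->; rewrite mpolyX0 mul1r.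
  have [p [q [s ->]]] := var_split i; have [p' [q' [s' ->]]] := var_split j.
  exists (p * p')%:MP, (p * q' + q * p')%:MP, (q * q')%:MP, (p * s' + s * p'), (q * s' + s * q'), (s * s').
  split; try by rewrite -alg_mpolyC; apply: rpredZ; apply: dhomog1.
  by rewrite -!mul_mpolyC !(mpolyCD, mpolyCM); ring.
move=> /(mpolyX_split K) [i [m1 [/IH [f1 [f2 [f3 [a1 [a2 [a3 [h1 h2 h3 ->]]]]]]] ->]]].
have Xi1 : X i \is 1.-homog by rewrite dhomogX /= mdeg1.
have Xc1 : X c ^+ k.+1 \is k.+1.-homog.
  have h : X c \is 1.-homog by rewrite dhomogX /= mdeg1.
  by have := dhomogMn k.+1 h; rewrite mul1n.
have [p [q [s Xi]]] := var_split i.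
exists (f1 * X i + (a1 * p) *: X c ^+ k.+1), (f2 * X i + (a1 * q + a2 * p) *: X c ^+ k.+1),
  (f3 * X i + (a2 * q) *: X c ^+ k.+1), (a1 * s + a3 * p), (a2 * s + a3 * q), (a3 * s).
split; try by apply: rpredD; [rewrite mulrC; apply: (dhomogM (d := 1) (e := k)) | apply: rpredZ].
rewrite !exprS Xi -!mul_mpolyC !(mpolyCD, mpolyCM); ring.
Qed.

Lemma homog_second_order_split k f : f \is k.+2.-homog -> second_order_split k f.
Proof.
move=> fk; rewrite [f]mpolyE; have := dhomog_mf fk.
elim: (msupp f) => [|m s IH] hs.
  rewrite big_nil; exists 0, 0, 0, 0, 0, 0; split; rewrite ?rpred0 //.
  by rewrite !(mul0r, scale0r, addr0).
rewrite big_cons; apply: split_linear; first by apply: split_monomial; apply: hs; apply: mem_head.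
by apply: IH => m' m's; apply: hs; rewrite inE m's orbT.
Qed.

Let ac : a != c. Proof. by rewrite -subr_eq0 addrAC subrr add0r. Qed.
Let bc : b != c. Proof. by rewrite -subr_eq0 addrAC subrr add0r. Qed.
Let ab : (a == b) = false. Proof. by rewrite (inj_eq (addrI c)). Qed.

Lemma singular_split k f : f \is k.+2.-homog -> f.@[x 0] = 0 ->
  (forall i, (f^`M(i)).@[x 0] = 0) ->
  exists f11 f12 f22, [/\ f11 \is k.-homog, f12 \is k.-homog, f22 \is k.-homog &
    f = f11 * L a ^+ 2 + f12 * L a * L b + f22 * L b ^+ 2].
Proof.
move=> /homog_second_order_split [f1 [f2 [f3 [al [be [ga [h1 h2 h3 fE]]]]]]] fx dfx.
exists f1, f2, f3; split=> //.
have La0 := meval_vanishing_form a; have Lb0 := meval_vanishing_form b.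
have ga0 : ga = 0.
  have Xk : (X c ^+ k.+2).@[x 0] = x 0 c ^+ k.+2 by rewrite rmorphXn /= mevalXU.
  move: fx; rewrite fE; move: (X c ^+ k.+1) (X c ^+ k.+2) (L a) (L b) Xk La0 Lb0 => Y Z U V Zx La0 Lb0.
  rewrite !mevalD !mevalM !mevalD !mevalZ La0 Lb0 Zx !(mulr0, mul0r, add0r).
  by move/eqP; rewrite mulf_eq0 expf_eq0 (negPf xc) andbF orbF => /eqP.
have der i : i != c -> (al * (x 0 c * (a == i)%:R) + be * (x 0 c * (b == i)%:R)) * x 0 c ^+ k.+1 = 0.
  move=> ic; have Xk : (X c ^+ k.+1).@[x 0] = x 0 c ^+ k.+1 by rewrite rmorphXn /= mevalXU.
  rewrite -[RHS](dfx i) fE ga0 scale0r addr0; move: (X c ^+ k.+1) Xk => Y <-.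
  move: (L a) (L b) La0 Lb0 (mderiv_vanishing_form a ic) (mderiv_vanishing_form b ic) => U V U0 V0 dU dV.
  rewrite !mderivD !mevalD !expr2 !meval_mderivM !mevalD !mevalM !mderivD !mderivZ.
  rewrite dU dV !mevalD !mevalZ !mevalC U0 V0.
  by rewrite !(mulr0, mul0r, add0r, addr0) mulrDl.
have xk : x 0 c ^+ k.+1 != 0 by rewrite expf_neq0.
have al0 : al = 0.
  have := der a ac; rewrite eqxx [b == a]eq_sym ab !mulr0 mulr1 addr0 => /eqP.
  by rewrite !mulf_eq0 (negPf xc) (negPf xk) !orbF => /eqP.
have be0 : be = 0.
  have := der b bc; rewrite eqxx ab !mulr0 mulr1 add0r => /eqP.
  by rewrite !mulf_eq0 (negPf xc) (negPf xk) !orbF => /eqP.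
by rewrite fE al0 be0 ga0 !(scale0r, addr0, mul0r).
Qed.

End Decomposition.

Lemma mwiden_quadratic n (K : fieldType) (a b c s t : {mpoly K[n]}) :
  mwiden (a * s ^+ 2 + b * s * t + c * t ^+ 2) =
  mwiden a * mwiden s ^+ 2 + mwiden b * mwiden s * mwiden t + mwiden c * mwiden t ^+ 2.
Proof. by rewrite !mwidenD !mwidenM; ring. Qed.

Section SingularLine.
Variable K : closedFieldType.
Hypothesis charK : 2%N \in [pchar K].
Variables (Q G B : {mpoly K[3]}).
Hypotheses (Q2 : Q \is 2.-homog) (G3 : G \is 3.-homog) (B4 : B \is 4.-homog).
Local Notation F := (taylor_form Q G B).
Local Notation widen := (widen_ord (leqnSn 3)).

(** By [singular_split] each of Q, G and B is a quadratic form in the linear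
    forms that vanish at x, hence so is F; at the centre P the coefficients of
    that quadratic form are those of Q, which are not all zero. *)
Lemma not_normal_of_singular_line (x : 'rV[K]_3) : Q != 0 -> x != 0 ->
  Q.@[x 0] = 0 -> G.@[x 0] = 0 -> B.@[x 0] = 0 ->
  (forall i, (Q^`M(i)).@[x 0] = 0) -> (forall i, (G^`M(i)).@[x 0] = 0) ->
  (forall i, (B^`M(i)).@[x 0] = 0) -> ~ normal_surface F.
Proof.
move=> Q0 /rV0Pn [c xc] Qx Gx Bx dQ dG dB.
have [q11 [q12 [q22 [q11h q12h q22h QE]]]] := singular_split xc Q2 Qx dQ.
have [g11 [g12 [g22 [g11h g12h g22h GE]]]] := singular_split xc G3 Gx dG.
have [b11 [b12 [b22 [b11h b12h b22h BE]]]] := singular_split xc B4 Bx dB.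
pose A (q g b : {mpoly K[3]}) : {mpoly K[4]} := 'X_ord_max ^+ 2 * mwiden q + 'X_ord_max * mwiden g + mwiden b.
have Ah q g b : q \is 0.-homog -> g \is 1.-homog -> b \is 2.-homog -> A q g b \is 2.-homog.
  move=> qh gh bh; have z1 : ('X_ord_max : {mpoly K[4]}) \is 1.-homog by rewrite dhomogX /= mdeg1.
  apply: rpredD; last exact: mwiden_homog.
  apply: rpredD; last by apply: (dhomogM (d := 1) (e := 1)) => //; apply: mwiden_homog.
  by apply: (dhomogM (d := 2) (e := 0)); [apply: (dhomogMn 2 z1) | apply: mwiden_homog].
pose P := cone_point (fun=> 0 : K) 1.
have P0 : P != 0.
  apply/negP => /eqP /(congr1 (fun M : 'rV[K]_4 => M 0 ord_max)).
  by rewrite cone_point_max mxE => /eqP; rewrite oner_eq0.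
have AP q g b : g \is 1.-homog -> b \is 2.-homog -> (A q g b).@[P 0] = q.@[fun=> 0].
  move=> gh bh; rewrite !mevalD !mevalM !meval_mwiden_cone mevalXU cone_point_max !mul1r.
  by rewrite (meval_homog0 gh) // (meval_homog0 bh) // !addr0.
have const (q : {mpoly K[3]}) : q \is 0.-homog -> q.@[fun=> 0] = 0 -> q = 0.
  move=> qh q00; apply/eqP/negPn/negP => q0.
  have /msize_poly1P [k k0 qk] : msize q == 1%N by rewrite (dhomog_msizeE qh q0).
  by move: q00 k0; rewrite qk mevalC => ->; rewrite eqxx.
set La := vanishing_form x c (c + 1) in QE GE BE.
set Lb := vanishing_form x c (c + 2) in QE GE BE.
have La1 : mwiden La \is 1.-homog by apply/mwiden_homog/vanishing_form_homog.
have Lb1 : mwiden Lb \is 1.-homog by apply/mwiden_homog/vanishing_form_homog.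
have wP (p : {mpoly K[3]}) : p \is 1.-homog -> (mwiden p).@[P 0] = 0.
  by move=> ph; rewrite meval_mwiden_cone (meval_homog0 ph).
have LaP := wP _ (vanishing_form_homog x c (c + 1)).
have LbP := wP _ (vanishing_form_homog x c (c + 2)).
have ac : c + 1 != c by rewrite -subr_eq0 addrAC subrr add0r.
have bc : c + 2 != c by rewrite -subr_eq0 addrAC subrr add0r.
have ab : (c + 1 == c + 2) = false by rewrite (inj_eq (addrI c)).
have ba : (c + 2 == c + 1) = false by rewrite eq_sym.
pose e (i : 'I_3) : 'I_4 -> K := fun j => (j == widen i)%:R.
have dire i (p : {mpoly K[3]}) : dirderiv (e i) (mwiden p) = mwiden p^`M(i).
  rewrite /dirderiv (bigD1 (widen i)) //= /e eqxx scale1r mderiv_mwiden big1 ?addr0 // => j /negPf ->.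
  by rewrite scale0r.
have dL i j : j != c -> (dirderiv (e j) (mwiden (vanishing_form x c i))).@[P 0] = x 0 c * (i == j)%:R.
  by move=> jc; rewrite dire mderiv_vanishing_form // mwidenC mevalC.
have Fh : F \is 4.-homog by exact: taylor_form_homog.
have FE : F = A q11 g11 b11 * mwiden La ^+ 2 + A q12 g12 b12 * mwiden La * mwiden Lb
            + A q22 g22 b22 * mwiden Lb ^+ 2.
  rewrite /taylor_form QE GE BE !mwiden_quadratic /A.
  move: (mwiden La) (mwiden Lb) (mwiden q11) (mwiden q12) (mwiden q22) => s t a1 a2 a3.
  move: (mwiden g11) (mwiden g12) (mwiden g22) (mwiden b11) (mwiden b12) (mwiden b22).
  by move=> *; ring.
apply: (not_normal_of_binary_form charK Fh FE (P := P) (u := e (c + 1)) (v := e (c + 2)) (k := x 0 c)) => //.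
- exact: Ah.
- exact: Ah.
- exact: Ah.
- by rewrite dL // eqxx mulr1.
- by rewrite dL // ba mulr0.
- by rewrite dL // ab mulr0.
- by rewrite dL // eqxx mulr1.
rewrite !AP //; case: (eqVneq q11.@[fun=> 0] 0) => [e11|]; last by constructor 1.
case: (eqVneq q12.@[fun=> 0] 0) => [e12|]; last by constructor 2.
constructor 3; apply: contraNneq Q0 => e22.
by rewrite QE (const q11) // (const q12) // (const q22) // !mul0r !addr0.
Qed.

End SingularLine.

(** * The resultant curves of degree ten *)

Lemma mpoly_rmorph_congr (K : fieldType) n (f : {rmorphism {mpoly K[n]} -> {mpoly K[n]}})
    (g : {mpoly K[n]}) :
  (forall c, f c%:MP = c%:MP) -> (forall i, rdvd g (f 'X_i - 'X_i)) ->
  forall p, rdvd g (f p - p).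
Proof.
move=> fC fX; elim/mpoly_ring_ind => [c|//|p q hp hq|p q hp hq].
- by rewrite fC subrr; apply: rdvd0.
- by rewrite rmorphD opprD addrACA; apply: rdvdD.
- rewrite rmorphM (_ : _ - _ = (f p - p) * f q + p * (f q - q)); last by ring.
  by apply: rdvdD; [apply: rdvd_mulr | apply: rdvd_mull].
Qed.

Section CharTwo.
Variable K : closedFieldType.
Hypothesis charK : 2%N \in [pchar K].

Lemma exists_sqrt (c : K) : exists r, r ^+ 2 = c.
Proof.
have : size ('X^2 - c%:P : {poly K}) != 1%N.
  by rewrite size_polyDl ?size_polyXn // size_polyN size_polyC; case: (c != 0).
case/closed_rootP => r /rootP; rewrite !hornerE => /eqP; rewrite subr_eq0 => /eqP <-.
by exists r.
Qed.

(** Only monomials with even exponents occur in f, and their coefficients have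
    square roots. *)
Lemma mpoly_sqrt n (f : {mpoly K[n]}) : (forall i, f^`M(i) = 0) -> exists h, f = h ^+ 2.
Proof.
move=> df; have even_supp m : m \in msupp f -> forall i, ~~ odd (m i).
  move=> mf i; apply: contraL mf => odd_mi; rewrite mcoeff_msupp negbK.
  have le : (U_(i) <= m)%MM by rewrite lep1mP; case: (m i) odd_mi.
  have /(congr1 (fun q => q@_(m - U_(i)))) := df i.
  rewrite mcoeff_mderiv mcoeff0 submK // mnmBE mnm1E eqxx subn1 prednK; last first.
    by case: (m i) odd_mi.
  rewrite -mulr_natr => /eqP; rewrite mulf_eq0 => /orP[//|].
  by rewrite -(dvdn_pcharf charK) dvdn2 odd_mi.
have char_f := mpoly_pchar2 n charK.
rewrite [f]mpolyE; elim: (msupp f) even_supp => [|m s IH] even_s.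
  by exists 0; rewrite big_nil expr0n.
have [|h he] := IH; first by move=> m' m's; apply: even_s; rewrite inE m's orbT.
have [r rm] := exists_sqrt f@_m; pose m2 := [multinom (m i)./2 | i < n].
have m2E : m = (m2 *+ 2)%MM.
  apply/mnmP => i; rewrite mulmnE mnmE muln2 -[LHS]odd_double_half.
  by rewrite (negPf (even_s m _ i)) ?mem_head.
exists (r *: 'X_[m2] + h).
rewrite big_cons he (_ : (_ + h) ^+ 2 = (r *: 'X_[m2]) ^+ 2 + h ^+ 2); last first.
  by rewrite sqrrD mulr2n (addrr_pchar2 char_f) addr0.
by rewrite exprZn rm mpolyXn -m2E.
Qed.

Lemma mpoly_sqrt_homog n k (f : {mpoly K[n]}) : f \is (2 * k).-homog ->
  (forall i, f^`M(i) = 0) -> exists2 h, h \is k.-homog & f = h ^+ 2.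
Proof.
move=> fk /mpoly_sqrt [h fh]; exists h => //.
have [->|h0] := eqVneq h 0; first exact: rpred0.
have hh0 : h * h != 0 by rewrite mulf_neq0.
move: fk; rewrite fh expr2 => hhk; have hd := dhomog_factor hhk hh0.
have := dhomog_uniq hh0 hhk (dhomogM hd hd); rewrite addnn -mul2n => /eqP.
by rewrite eqn_pmul2l // => /eqP ->.
Qed.

Lemma linear_homogE n (g : {mpoly K[n]}) : g \is 1.-homog -> g = \sum_i g@_U_(i) *: 'X_i.
Proof.
move=> g1; apply/mpolyP => m; rewrite raddf_sum /=.
under eq_bigr do rewrite mcoeffZ mcoeffX.
have [dm|dm] := eqVneq (mdeg m) 1%N; last first.
  rewrite (dhomog_nemf_coeff g1 dm) big1 // => i _.
  by rewrite (_ : (U_(i) == m)%MM = false) ?mulr0 //; apply: contraNF dm => /eqP <-; rewrite mdeg1.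
have /mdeg1P [i /eqP ->] : mdeg m == 1%N by rewrite dm.
rewrite (bigD1 i) //= eqxx mulr1 big1 ?addr0 // => j ji.
rewrite (_ : (U_(j) == U_(i))%MM = false) ?mulr0 //; apply: contraNF ji => /eqP /mnmP /(_ i).
by rewrite !mnm1E eqxx; case: eqP.
Qed.

Lemma linear_mderiv_const n (g : {mpoly K[n]}) i : g \is 1.-homog -> g^`M(i) = (g@_U_(i))%:MP.
Proof.
move=> g1; rewrite {1}(linear_homogE g1) raddf_sum /= (bigD1 i) //= mderivZ mderivXU eqxx.
rewrite big1 ?addr0 ?alg_mpolyC // => j /negPf ji.
by rewrite mderivZ mderivXU ji scaler0.
Qed.

(** Eliminating one variable by means of g = 0 turns S into a form with zero
    gradient, that is, into a square c^2. Then S + c^2 = g S1 has a gradient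
    divisible by g, and so g divides S1. *)
Lemma square_mod_double_line n k (g S : {mpoly K[n]}) : irreducible g -> g \is 1.-homog ->
  S \is (2 * k).-homog -> (forall i, rdvd g S^`M(i)) ->
  exists2 c, c \is k.-homog & rdvd (g ^+ 2) (S + c ^+ 2).
Proof.
move=> girr g1 Sk dS; have [g0 gU _] := girr.
have gE := linear_homogE g1; have dg i := linear_mderiv_const i g1.
have [j gj] : exists j, g@_U_(j) != 0.
  apply: NNPP => h; move: g0; rewrite gE big1 ?eqxx // => i _.
  have [->|gi] := eqVneq g@_U_(i) 0; first by rewrite scale0r.
  by case: h; exists i.
(* The substitution of a linear form in the other variables for the j-th one:
   it maps g to 2 g = 0. *)
pose t := [tuple 'X_i + (if i == j then (g@_U_(j))^-1 *: g else 0) | i < n].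
pose f : {rmorphism {mpoly K[n]} -> {mpoly K[n]}} := comp_mpoly t.
have fX i : f 'X_i = 'X_i + (if i == j then (g@_U_(j))^-1 *: g else 0).
  by rewrite /f /= comp_mpolyXU -tnth_nth tnth_mktuple.
have char_g := mpoly_pchar2 n charK.
have fg : f g = 0.
  rewrite {1}gE raddf_sum /=.
  transitivity (\sum_i (g@_U_(i) *: 'X_i + g@_U_(i) *: (if i == j then (g@_U_(j))^-1 *: g else 0))).
    by apply: eq_bigr => i _; rewrite comp_mpolyZ -scalerDr -fX.
  rewrite big_split /= -gE (bigD1 j) //= eqxx scalerA mulfV // scale1r big1 ?addr0.
    exact: addrr_pchar2.
  by move=> i /negPf ->; rewrite scaler0.
have [c ck cE] : exists2 c, c \is k.-homog & f S = c ^+ 2.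
  apply: mpoly_sqrt_homog.
    apply: comp_mpoly_homog => // i; rewrite tnth_mktuple; apply: rpredD.
      by rewrite dhomogX /= mdeg1.
    by case: ifP => _; rewrite ?rpred0 //; apply: rpredZ.
  move=> i; rewrite /f /= mderiv_comp big1 // => l _.
  have [h ->] := dS l; have := rmorphM f g h; rewrite /f /= => ->.
  by have := fg; rewrite /f /= => ->; rewrite !mul0r.
have [S1 S1E] : rdvd g (S + c ^+ 2).
  have : rdvd g (f S - S).
    apply: mpoly_rmorph_congr => [a|i]; first by rewrite /f /= comp_mpolyC.
    rewrite fX addrC addKr; case: eqP => _; last exact: rdvd0.
    by exists (g@_U_(j))^-1%:MP; rewrite mulrC mul_mpolyC.
  by rewrite cE; rewrite (oppr_pchar2 char_g) addrC.
exists c => //; have : rdvd g S1.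
  have : rdvd g (g^`M(j) * S1).
    have := congr1 (mderiv j) S1E; rewrite mderivD expr2 mderivM.
    rewrite [_ * c]mulrC (addrr_pchar2 char_g) addr0 mderivM => e.
    rewrite (_ : _ * S1 = S^`M(j) - g * S1^`M(j)); last by rewrite e addrK.
    by apply: rdvdB => //; apply: rdvd_mulr; apply: rdvdxx.
  case/(prime_dvdM girr) => //; rewrite dg => -[a /esym e].
  have : g * a \is a GRing.unit by rewrite e rmorph_unit // unitfE.
  by rewrite unitrM (negPf gU).
by case=> S2 S2E; exists S2; rewrite S1E S2E expr2 mulrA.
Qed.


Section ResultantCurve.
Variables (Q G B : {mpoly K[3]}).
Hypotheses (Q2 : Q \is 2.-homog) (G3 : G \is 3.-homog) (B4 : B \is 4.-homog).
Hypotheses (G0 : G != 0) (F_normal : normal_surface (taylor_form Q G B)).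

(** The resultant in z of z^2 Q + B and z^2 Q_i + z G_i + B_i. *)
Definition height_resultant i : {mpoly K[3]} := (Q * B)^`M(i) ^+ 2 + Q * B * G^`M(i) ^+ 2.

Lemma QB_homog : Q * B \is 6.-homog.
Proof. exact: (dhomogM (d := 2) (e := 4)). Qed.

Lemma height_resultant_homog i : height_resultant i \is 10.-homog.
Proof.
apply: rpredD; first exact: (dhomogMn 2 (mderiv_homog i QB_homog)).
by apply: (dhomogM (d := 6) (e := 4)); [exact: QB_homog | exact: (dhomogMn 2 (mderiv_homog i G3))].
Qed.

Lemma irreducible_homog_deg_gt0 n d (g : {mpoly K[n]}) :
  irreducible g -> g \is d.-homog -> (0 < d)%N.
Proof.
case=> g0 gU _ gd; rewrite lt0n; apply: contra gU => /eqP d0.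
by rewrite mpoly_unit_msize (dhomog_msizeE gd g0) d0.
Qed.

Lemma rdvd_mderiv n d (g : {mpoly K[n]}) i : irreducible g -> g \is d.-homog ->
  rdvd g g^`M(i) -> g^`M(i) = 0.
Proof.
move=> girr gd; have := irreducible_homog_deg_gt0 girr gd.
case: d gd => // d gd _; apply: (rdvd_small gd (mderiv_homog i gd)) => //.
Qed.

(** Otherwise g would be a square. *)
Lemma exists_mderiv_neq0 n d (g : {mpoly K[n]}) : irreducible g -> g \is d.-homog ->
  exists i, g^`M(i) != 0.
Proof.
move=> girr gd; apply: NNPP => h; have [q gq] : exists q, g = q ^+ 2.
  by apply: mpoly_sqrt => i; apply/eqP/negPn/negP => gi; apply: h; exists i.
have [_ gU gI] := girr; have [] := gI q q gq => qU;
  by move: gU; rewrite gq expr2 unitrM qU.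
Qed.

(** If g^2 does not divide G, take i with g_i not zero. Were W_i divisible by g,
    the equation z Q G_i + (Q B)_i = 0 would define a double curve over g = 0:
    [not_normal_of_integral_fraction] applies to a = Q G_i and b = (Q B)_i,
    because the i-th derivative of W_i + G_i (Q B)_i G is a multiple of g.
    If g^2 divides G, then g is linear, and if g divides all W_i it divides the
    gradient of Q B; then Q B is a square c^2 modulo g^2, and a = Q, b = c. *)
Lemma not_rdvd_height_resultant d (g : {mpoly K[3]}) : irreducible g -> g \is d.-homog ->
  rdvd g G -> ~ rdvd g Q -> exists i, ~ rdvd g (height_resultant i).
Proof.
move=> girr gd [r GE] gQ; have [g0 gU _] := girr.
have d_gt0 := irreducible_homog_deg_gt0 girr gd.
have char3 := mpoly_pchar2 3 charK; have dbl := addrr_pchar2 char3.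
have d3 : (d <= 3)%N.
  rewrite -ltnS -(dhomog_msizeE gd g0) -(dhomog_msizeE G3 G0).
  by apply: rdvd_msize => //; exists r.
have [[s rs]|gr] := classic (rdvd g r).
  have GE2 : G = g ^+ 2 * s by rewrite GE rs expr2 mulrA.
  have d1 : d = 1%N.
    have : (d + d <= 3)%N.
      rewrite -ltnS -(dhomog_msizeE (dhomogM gd gd)) ?mulf_neq0 // -(dhomog_msizeE G3 G0).
      by apply: rdvd_msize => //; exists s; rewrite GE2 expr2.
    by move: d_gt0; clear; lia.
  rewrite d1 in gd; apply: NNPP => h.
  have dV i : rdvd g (Q * B)^`M(i).
    have gW : rdvd g (height_resultant i) by apply: NNPP => gW; apply: h; exists i.
    apply: (rdvd_exp (k := 2)) => //.
    have -> : (Q * B)^`M(i) ^+ 2 = height_resultant i - Q * B * G^`M(i) ^+ 2 by rewrite /height_resultant addrK.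
    apply: rdvdB => //; rewrite expr2; apply: rdvd_mull; apply: rdvd_mulr.
    rewrite GE2 mderivM expr2 mderivM; apply: rdvdD; last first.
      by apply: rdvd_mulr; apply: rdvd_mulr; apply: rdvdxx.
    by rewrite [_ * g]mulrC dbl mul0r; apply: rdvd0.
  have [c ck [t ct]] := square_mod_double_line (k := 3) girr gd QB_homog dV.
  have [x [gx QQx]] : exists x, g.@[x] = 0 /\ (Q * Q).@[x] != 0.
    by apply: nullstellensatz_hypersurface => // /(prime_dvdM girr)[].
  move: QQx; rewrite mevalM mulf_eq0 negb_or => /andP[Qx _].
  apply: (not_normal_of_integral_fraction charK Q2 G3 B4 gd Q2 ck _ _ g0 _ _ gx Qx Qx F_normal) => //.
    by exists r.
  exists (Q * (c * s + t)); transitivity (Q * (c * G + (Q * B + c ^+ 2))); first by ring.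
  by rewrite ct GE2; ring.
have [i gi] := exists_mderiv_neq0 girr gd.
have ggi : ~ rdvd g g^`M(i) by move/(rdvd_mderiv girr gd) => e; rewrite e eqxx in gi.
have gGi : ~ rdvd g G^`M(i).
  move=> h; have : rdvd g (g^`M(i) * r).
    rewrite (_ : _ * r = G^`M(i) - g * r^`M(i)); last by rewrite GE mderivM addrK.
    by apply: rdvdB => //; apply: rdvd_mulr; apply: rdvdxx.
  by case/(prime_dvdM girr).
exists i => gW; set V := (Q * B)^`M(i); set Gi := G^`M(i) in gGi.
have [x [gx ax]] : exists x, g.@[x] = 0 /\ (Q * (Q * Gi)).@[x] != 0.
  by apply: nullstellensatz_hypersurface => // /(prime_dvdM girr)[|/(prime_dvdM girr)[]].
move: ax; rewrite mevalM mulf_eq0 negb_or => /andP[Qx ax].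
have ad : Q * Gi \is 4.-homog by apply: (dhomogM (d := 2) (e := 2)) => //; apply: mderiv_homog.
have bd : V \is 5.-homog by apply/mderiv_homog/QB_homog.
apply: (not_normal_of_integral_fraction charK Q2 G3 B4 gd ad bd _ _ g0 _ _ gx Qx ax F_normal) => //.
- exact: leq_trans d3 _.
- by exists r.
have [M1 M1E] : rdvd g (height_resultant i + Gi * V * G).
  by apply: rdvdD => //; rewrite GE; apply: rdvd_mull; apply: rdvd_mulr; apply: rdvdxx.
have [M2 M2E] : rdvd g M1.
  have : rdvd g (g^`M(i) * M1).
    have := congr1 (mderiv i) M1E.
    rewrite mderivM mderivD /height_resultant mderivD -/V -/Gi => e.
    rewrite (_ : _ * M1 = (Gi * V)^`M(i) * G - g * M1^`M(i)).
      apply: rdvdB; last by apply: rdvd_mulr; apply: rdvdxx.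
      by rewrite GE; apply: rdvd_mull; apply: rdvd_mulr; apply: rdvdxx.
    rewrite -[LHS](addrK (g * M1^`M(i))) -e; congr (_ - _).
    have sq (p : {mpoly K[3]}) : (p ^+ 2)^`M(i) = 0.
      by rewrite expr2 mderivM [_ * p]mulrC dbl.
    rewrite sq mderivM sq -/V mulr0 addr0 add0r [(_ * G)^`M(i)]mderivM -/Gi addrCA.
    by rewrite (_ : V * Gi ^+ 2 = Gi * V * Gi) ?dbl ?addr0 //; ring.
  by case/(prime_dvdM girr).
exists (Q * M2); transitivity (Q * (height_resultant i + Gi * V * G)).
  by rewrite /height_resultant -/V -/Gi; ring.
by rewrite M1E M2E; ring.
Qed.

End ResultantCurve.
End CharTwo.

(** * Singular points over one component of the branch cubic *)

Lemma size_by_fibers (T U : eqType) (f : T -> U) (s : seq T) (xs : seq U) :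
  uniq xs -> (forall p, p \in s -> f p \in xs) ->
  size s = (\sum_(x <- xs) count (fun p => f p == x) s)%N.
Proof.
move=> uxs; elim: s => [|p s IH] fs; first by rewrite big1.
rewrite [LHS]/= IH => [|q qs]; last by apply: fs; rewrite inE qs orbT.
rewrite big_split /= -add1n; congr (_ + _)%N.
have e : count_mem (f p) xs = 1%N by rewrite (count_uniq_mem _ uxs) fs // mem_head.
by rewrite -{1}e -sum1_count big_mkcond; apply: eq_bigr => x _; rewrite /= eq_sym; case: (_ == _).
Qed.

Lemma size_le_fibers (T U : eqType) (f : T -> U) (s : seq T) (bad : pred U) :
  (forall x, x \in [seq f p | p <- s] -> (count (fun p => f p == x) s <= 1 + bad x)%N) ->
  (size s <= size (undup [seq f p | p <- s]) + size (filter bad (undup [seq f p | p <- s])))%N.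
Proof.
move=> h; have fs p : p \in s -> f p \in undup [seq f q | q <- s].
  by move=> ps; rewrite mem_undup map_f.
rewrite {1}(size_by_fibers (undup_uniq _) fs) size_filter -sum1_size -sum1_count.
rewrite [X in (_ <= _ + X)%N]big_mkcond -big_split /= big_seq [X in (_ <= X)%N]big_seq.
apply: leq_sum => x; rewrite mem_undup => /h.
by case: (bad x).
Qed.

Lemma count_le1 (T : eqType) (a : pred T) (s : seq T) : uniq s ->
  (forall p q, p \in s -> q \in s -> a p -> a q -> p = q) -> (count a s <= 1)%N.
Proof.
move=> us h; rewrite -size_filter; case E: (filter a s) => [|p [|q r]] //=.
have us' : uniq (filter a s) by apply: filter_uniq.
have mp : p \in filter a s by rewrite E mem_head.
have mq : q \in filter a s by rewrite E !inE eqxx orbT.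
move: mp mq us'; rewrite !mem_filter => /andP[ap ps] /andP[aq qs].
by rewrite E (h p q ps qs ap aq) /= mem_head.
Qed.

Lemma count_le2 (T : eqType) (a : pred T) (s : seq T) : uniq s ->
  (forall p q r, p \in s -> q \in s -> r \in s -> a p -> a q -> a r ->
     [\/ p = q, p = r | q = r]) -> (count a s <= 2)%N.
Proof.
move=> us h; rewrite -size_filter; case E: (filter a s) => [|p [|q [|r t]]] //=.
have us' : uniq (filter a s) by apply: filter_uniq.
have mp : p \in filter a s by rewrite E mem_head.
have mq : q \in filter a s by rewrite E !inE eqxx orbT.
have mr : r \in filter a s by rewrite E !inE eqxx !orbT.
move: mp mq mr us'; rewrite !mem_filter => /andP[ap ps] /andP[aq qs] /andP[ar rs].
rewrite E /= !inE !negb_or.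
by case: (h p q r ps qs rs ap aq ar) => ->; rewrite eqxx ?andbF.
Qed.

Section Components.
Variable K : closedFieldType.
Hypothesis charK : 2%N \in [pchar K].
Variables (Q G B : {mpoly K[3]}).
Hypotheses (Q2 : Q \is 2.-homog) (G3 : G \is 3.-homog) (B4 : B \is 4.-homog).
Hypotheses (Q0 : Q != 0) (G0 : G != 0).
Local Notation F := (taylor_form Q G B).
Hypothesis F_normal : normal_surface F.
Local Notation widen := (widen_ord (leqnSn 3)).

Definition base (p : 'rV[K]_4) : 'rV[K]_3 := \row_i p 0 (widen i).
Definition height (p : 'rV[K]_4) : K := p 0 ord_max.

Lemma cone_pointE p : p = cone_point (base p 0) (height p).
Proof.
apply/rowP => i; case: (unliftP ord_max i) => [j ->|->]; last by rewrite cone_point_max.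
by rewrite lift_ord_max cone_point_widen mxE.
Qed.

Lemma meval_mwiden_base (p : 'rV[K]_4) (q : {mpoly K[3]}) : (mwiden q).@[p 0] = q.@[base p 0].
Proof. by rewrite {1}(cone_pointE p) meval_mwiden_cone. Qed.

Lemma singular_G p : singular_point F p -> G.@[base p 0] = 0.
Proof.
by case=> _ _ /(_ ord_max); rewrite mderiv_taylor_max // meval_mwiden_base.
Qed.

Lemma mderiv_taylor_widen i :
  F^`M(widen i) = taylor_form Q^`M(i) G^`M(i) B^`M(i).
Proof.
have zi : ('X_ord_max : {mpoly K[4]})^`M(widen i) = 0.
  by rewrite mderivXU -val_eqE /= gtn_eqF.
have mz (c p : {mpoly K[4]}) : c^`M(widen i) = 0 -> (c * p)^`M(widen i) = c * p^`M(widen i).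
  by move=> c0; rewrite mderivM c0 mul0r add0r.
have z2 : ('X_ord_max ^+ 2 : {mpoly K[4]})^`M(widen i) = 0.
  by rewrite expr2 (mz _ _ zi) zi mulr0.
by rewrite /taylor_form !mderivD (mz _ _ z2) (mz _ _ zi) !mderiv_mwiden.
Qed.

Lemma meval_taylor_base (q g b : {mpoly K[3]}) (p : 'rV[K]_4) :
  (taylor_form q g b).@[p 0] =
  height p ^+ 2 * q.@[base p 0] + height p * g.@[base p 0] + b.@[base p 0].
Proof. by rewrite {1}(cone_pointE p) meval_taylor. Qed.

Lemma singular_B p : singular_point F p -> B.@[base p 0] = height p ^+ 2 * Q.@[base p 0].
Proof.
move=> sp; have [_ + _] := sp; rewrite meval_taylor_base (singular_G sp) mulr0 addr0.
by move/eqP; rewrite addrC addr_eq0 (oppr_pchar2 charK) => /eqP.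
Qed.

Lemma singular_mderiv p i : singular_point F p ->
  height p ^+ 2 * (Q^`M(i)).@[base p 0] + height p * (G^`M(i)).@[base p 0]
    + (B^`M(i)).@[base p 0] = 0.
Proof.
by case=> _ _ /(_ (widen i)) <-; rewrite mderiv_taylor_widen meval_taylor_base.
Qed.

Lemma singular_dirderiv p u : singular_point F p ->
  height p ^+ 2 * (dirderiv u Q).@[base p 0] + height p * (dirderiv u G).@[base p 0]
    + (dirderiv u B).@[base p 0] = 0.
Proof.
move=> sp; rewrite /dirderiv !raddf_sum /= !mulr_sumr -!big_split /= big1 // => i _.
by rewrite !mevalZ -[RHS](mulr0 (u i)) -(singular_mderiv i sp); ring.
Qed.

Lemma singular_height_resultant p i : singular_point F p -> (height_resultant Q G B i).@[base p 0] = 0.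
Proof.
move=> sp; have hB := singular_B sp; have := singular_mderiv i sp.
rewrite /height_resultant mevalD !expr2 !mevalM mderivM mevalD !mevalM hB.
set q := Q.@[_]; set qi := (Q^`M(i)).@[_]; set gi := (G^`M(i)).@[_]; set t := height p.
move=> e; have -> : (B^`M(i)).@[base p 0] = t ^+ 2 * qi + t * gi.
  by move: e => /eqP; rewrite addrC addr_eq0 (oppr_pchar2 charK) => /eqP.
have dbl (c : K) : c + c = 0 := addrr_pchar2 charK c.
have -> : qi * (t ^+ 2 * q) + q * (t ^+ 2 * qi + t * gi) = q * t * gi.
  by rewrite -[RHS]add0r -(dbl (qi * (t ^+ 2 * q))); ring.
by rewrite -[RHS](dbl (q * t * gi * (q * t * gi))); ring.
Qed.

Lemma singular_height_resultant_tangent p i u : singular_point F p ->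
  (dirderiv u G).@[base p 0] = 0 -> (dirderiv u (height_resultant Q G B i)).@[base p 0] = 0.
Proof.
move=> sp dG; have hB := singular_B sp; have := singular_dirderiv u sp.
rewrite dG mulr0 addr0 /height_resultant => /eqP; rewrite addrC addr_eq0 (oppr_pchar2 charK) => /eqP e.
rewrite linearD /= dirderiv_sqr // add0r dirderivM dirderiv_sqr // mulr0 addr0.
rewrite mevalM dirderivM mevalD !mevalM e hB.
rewrite (_ : _ + _ = 0) ?mul0r // -[RHS](addrr_pchar2 charK ((dirderiv u Q).@[base p 0] *
  (height p ^+ 2 * Q.@[base p 0]))); ring.
Qed.

Lemma no_vertical_line x : normalized x -> Q.@[x 0] = 0 -> G.@[x 0] = 0 -> B.@[x 0] = 0 ->
  (forall i, (Q^`M(i)).@[x 0] = 0) -> (forall i, (G^`M(i)).@[x 0] = 0) ->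
  (forall i, (B^`M(i)).@[x 0] = 0) -> False.
Proof.
move=> /andP[x0 _] Qx Gx Bx dQ dG dB.
exact: (not_normal_of_singular_line charK Q2 G3 B4 Q0 x0 Qx Gx Bx dQ dG dB F_normal).
Qed.

Lemma eq_of_base_height p q : base p = base q -> height p = height q -> p = q.
Proof. by move=> hb hh; rewrite (cone_pointE p) (cone_pointE q) hb hh. Qed.

(** The difference of the equations z^2 Q = B at two heights is (z + z')^2 Q,
    and similarly z + z' is a factor of the difference for the derivatives. *)
Lemma singular_fiber2 p q : singular_point F p -> singular_point F q -> base p = base q ->
  p != q -> Q.@[base p 0] = 0 /\
  forall i, (height p + height q) * (Q^`M(i)).@[base p 0] = (G^`M(i)).@[base p 0].
Proof.
move=> sp sq pq npq; have th : height p + height q != 0.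
  apply: contraNneq npq => /eqP; rewrite addr_eq0 (oppr_pchar2 charK) => /eqP e.
  exact/eqP/eq_of_base_height.
have dbl (c : K) : c + c = 0 := addrr_pchar2 charK c.
split.
  have := singular_B sp; rewrite pq (singular_B sq) => e.
  apply: (mulfI (expf_neq0 2 th)); rewrite mulr0 -[RHS](dbl (height q ^+ 2 * Q.@[base q 0])).
  rewrite {2}e sqrrD mulr2n (dbl (_ * _)) addr0; ring.
move=> i; have := singular_mderiv i sp; rewrite pq => e1; have := singular_mderiv i sq => e2.
move: e1 e2; set qi := (Q^`M(i)).@[_]; set gi := (G^`M(i)).@[_]; set bi := (B^`M(i)).@[_].
set s := height p in th *; set t := height q in th * => e1 e2.
have e : (s + t) * ((s + t) * qi + gi) = 0.
  transitivity ((s ^+ 2 * qi + s * gi + bi) + (t ^+ 2 * qi + t * gi + bi)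
    + (s * t * qi + s * t * qi) - (bi + bi)); first by ring.
  by rewrite e1 e2 !dbl subr0.
by move/eqP: e; rewrite mulf_eq0 (negPf th) /= addr_eq0 (oppr_pchar2 charK) => /eqP.
Qed.

Lemma fiber_le1 p q : singular_point F p -> singular_point F q -> base p = base q ->
  normalized (base p) ->
  Q.@[base p 0] != 0 \/ (forall i, (Q^`M(i)).@[base p 0] = 0) -> p = q.
Proof.
move=> sp sq pq np h; apply/eqP/negPn/negP => npq.
have [Qx dG] := singular_fiber2 sp sq pq npq.
case: h => [|dQ]; first by rewrite Qx eqxx.
have dG0 i : (G^`M(i)).@[base p 0] = 0 by rewrite -dG dQ mulr0.
apply: (no_vertical_line np Qx (singular_G sp) _ dQ dG0) => [|i].
  by rewrite singular_B // Qx mulr0.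
by have := singular_mderiv i sp; rewrite dQ dG0 !mulr0 !add0r.
Qed.

Lemma fiber_le2 p q r : singular_point F p -> singular_point F q -> singular_point F r ->
  normalized (base p) -> base p = base q -> base p = base r ->
  [\/ p = q, p = r | q = r].
Proof.
move=> sp sq sr np pq pr.
have [->|npq] := eqVneq p q; first by constructor 1.
have [->|npr] := eqVneq p r; first by constructor 2.
have [_ h1] := singular_fiber2 sp sq pq npq; have [_ h2] := singular_fiber2 sp sr pr npr.
have [->|nqr] := eqVneq q r; first by constructor 3.
case/eqP: npq; apply: fiber_le1 => //; right=> i.
have : (height q - height r) * (Q^`M(i)).@[base p 0] = 0.
  rewrite -[RHS](subrr ((G^`M(i)).@[base p 0])) -{1}h1 -h2; ring.
move/eqP; rewrite mulf_eq0 subr_eq0 => /orP[/eqP hqr|/eqP //].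
by case/eqP: nqr; apply: eq_of_base_height => //; rewrite -pq.
Qed.

Definition good_singular (p : 'rV[K]_4) : Prop := singular_point F p /\ normalized (base p).

(** Otherwise g would divide F, which is irreducible of larger degree. *)
Lemma component_not_rdvd_B d (g : {mpoly K[3]}) : irreducible g -> g \is d.-homog ->
  (d < 4)%N -> rdvd g Q -> rdvd g G -> ~ rdvd g B.
Proof.
move=> girr gd d4 [q qE] [r rE] [b bE]; have [[F0 FU FI] _] := F_normal.
have d0 := irreducible_homog_deg_gt0 girr gd; have [g0 _ _] := girr.
have wd := mwiden_homog gd.
have w0 : mwiden g != 0 by rewrite -(inj_eq (@inj_mwiden 3 K)) mwiden0 in g0 *.
have FE : F = mwiden g * ('X_ord_max ^+ 2 * mwiden q + 'X_ord_max * mwiden r + mwiden b).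
  rewrite /taylor_form qE rE bE !mwidenM; ring.
case: (FI _ _ FE) => [|U].
  by rewrite mpoly_unit_msize (dhomog_msizeE wd w0) eqSS => /eqP d00; rewrite d00 in d0.
suff : rdvd F (mwiden g).
  by move/(rdvd_small (taylor_form_homog Q2 G3 B4) wd d4) => w00; rewrite w00 eqxx in w0.
by rewrite FE; exists (('X_ord_max ^+ 2 * mwiden q + 'X_ord_max * mwiden r + mwiden b)^-1);
  rewrite -mulrA mulrV // mulr1.
Qed.

Lemma component_count d (g : {mpoly K[3]}) (s : seq 'rV[K]_4) :
  irreducible g -> g \is d.-homog -> rdvd g G -> uniq s ->
  (forall p, p \in s -> good_singular p /\ g.@[base p 0] = 0) ->
  (size s <= 8 * d)%N /\ ((forall i, Q^`M(i) = 0) -> (size s <= 5 * d)%N).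
Proof.
move=> girr gd gG us hs; have [g0 _ _] := girr.
have d4 : (d < 4)%N.
  by rewrite -(dhomog_msizeE gd g0) -(dhomog_msizeE G3 G0); apply: rdvd_msize.
set xs := undup [seq base p | p <- s]; have uxs : uniq xs by apply: undup_uniq.
have xsP x : x \in xs -> exists2 p, p \in s & x = base p by rewrite mem_undup => /mapP.
have fib2 x : x \in [seq base p | p <- s] -> (count (fun p => base p == x) s <= 2)%N.
  move=> _; apply: count_le2 => // p q r /hs[[sp np] _] /hs[[sq _] _] /hs[[sr _] _].
  by move=> /eqP <- /eqP eq /eqP er; apply: fiber_le2.
have fib1 (x : 'rV[K]_3) : (Q.@[x 0] != 0 \/ (forall i, Q^`M(i) = 0)) ->
    x \in [seq base p | p <- s] -> (count (fun p => base p == x) s <= 1)%N.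
  move=> hx _; apply: count_le1 => // p q /hs[[sp np] _] /hs[[sq _] _].
  move=> /eqP ep /eqP eq; apply: fiber_le1 => //; first by rewrite ep eq.
  by rewrite ep; case: hx => [|hx]; [left | right => i; rewrite hx meval0].
have size1 : (forall i, Q^`M(i) = 0) -> (size s <= size xs)%N.
  move=> dQ; have fib (x : 'rV[K]_3) : x \in [seq base p | p <- s] ->
      (count (fun p => base p == x) s <= 1 + false)%N by exact: (fib1 x (or_intror dQ)).
  by have := size_le_fibers (bad := pred0) fib; rewrite -/xs filter_pred0 addn0.
(* On a component of Q = 0 the height is not determined by z^2 Q = B; there
   are few points x instead, since B vanishes at them. *)
have [gQ|gQ] := classic (rdvd g Q).
  have nB := component_not_rdvd_B girr gd d4 gQ gG.
  have xs4 : (size xs <= d * 4)%N.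
    apply: (bezout_points charK gd B4 girr nB uxs) => x /xsP [p /hs[[sp np] gp] ->].
    split=> //; rewrite singular_B //; case: gQ => c ->.
    by rewrite mevalM gp mul0r mulr0.
  split=> [|/size1 h]; last by move: h xs4; clear; lia.
  have := @size_le_fibers _ _ base s predT; rewrite filter_predT -/xs => /(_ fib2) h.
  apply: leq_trans h _; rewrite (_ : 8 * d = d * 4 + d * 4)%N; first exact: leq_add.
  by clear; lia.
have [i gW] := not_rdvd_height_resultant charK Q2 G3 B4 G0 F_normal girr gd gG gQ.
have xs5 : (2 * size xs <= d * 10)%N.
  apply: (bezout_tangent charK gd (height_resultant_homog Q2 G3 B4 i) girr gW uxs).
  move=> x /xsP [p /hs[[sp np] gp] ->]; split=> //; first exact: singular_height_resultant.
  move=> u gu; apply: singular_height_resultant_tangent => //.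
  by case: gG => r ->; rewrite meval_dirderivM_zero.
split=> [|/size1 h]; last by move: h xs5; clear; lia.
(* Only over these points there can be two heights. *)
pose bad (x : 'rV[K]_3) := Q.@[x 0] == 0.
have Qxs : (size (filter bad xs) <= d * 2)%N.
  apply: (bezout_points charK gd Q2 girr gQ); first exact: filter_uniq.
  move=> x; rewrite mem_filter => /andP[/eqP Qx /xsP [p /hs[[sp np] gp] xp]].
  by rewrite xp in Qx *.
have fib (x : 'rV[K]_3) : x \in [seq base p | p <- s] ->
    (count (fun p => base p == x) s <= 1 + bad x)%N.
  rewrite /bad; case: eqP => Qx; first exact: fib2.
  by apply: fib1; left; apply/eqP.
have h : (size s <= size xs + size (filter bad xs))%N := size_le_fibers fib.
by move: h xs5 Qxs; move: (size (filter bad xs)) (size s) (size xs) => a b c; clear; lia.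
Qed.

End Components.

(** * All singular points of a surface in Taylor form *)

(** A duplicate-free list of maximal length contains everything. *)
Lemma maximal_uniq_list (T : eqType) (P : T -> Prop) N :
  (forall s : seq T, uniq s -> (forall x, x \in s -> P x) -> (size s <= N)%N) ->
  exists2 s : seq T, (size s <= N)%N & forall x, P x -> x \in s.
Proof.
move=> bound; apply: NNPP => nex.
have : forall k, exists2 s : seq T, uniq s & size s = k /\ forall x, x \in s -> P x.
  elim=> [|k [s us [sk sP]]]; first by exists [::].
  have [x [Px xs]] : exists x, P x /\ x \notin s.
    apply: NNPP => h; apply: nex; exists s; first exact: bound.
    by move=> x Px; apply/negPn/negP => xs; apply: h; exists x.
  exists (x :: s); first by rewrite /= xs.
  by split=> [|y]; rewrite /= ?sk // inE => /orP[/eqP ->|/sP].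
case/(_ N.+1) => s us [sN sP]; have := bound s us sP.
by rewrite sN ltnn.
Qed.

Section TaylorCount.
Variable K : closedFieldType.
Hypothesis charK : 2%N \in [pchar K].
Variables (Q G B : {mpoly K[3]}).
Hypotheses (Q2 : Q \is 2.-homog) (G3 : G \is 3.-homog) (B4 : B \is 4.-homog).
Hypotheses (Q0 : Q != 0) (G0 : G != 0).
Local Notation F := (taylor_form Q G B).
Hypothesis F_normal : normal_surface F.

(** Induction over the factorization of H; a point of the cubic over which
    there is a singular point lies on one of the factors. *)
Lemma divisor_count e (H : {mpoly K[3]}) (s : seq 'rV[K]_4) :
  H \is e.-homog -> rdvd H G -> uniq s ->
  (forall p, p \in s -> good_singular Q G B p /\ H.@[base p 0] = 0) ->
  (size s <= 8 * e)%N /\ ((forall i, Q^`M(i) = 0) -> (size s <= 5 * e)%N).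
Proof.
elim/ltn_ind: e H s => e IH H s He HG us hs.
have H0 : H != 0 by apply: contraNneq G0 => H0; case: HG => c ->; rewrite H0 mul0r.
have [/mpoly_unitP [c c0 Hc]|HU] := boolP (H \is a GRing.unit).
  case: s us hs => [|p s] // _ /(_ p (mem_head _ _)) [_].
  by rewrite Hc mevalC => c00; rewrite c00 eqxx in c0.
have [Hirr|Hred] := classic (irreducible H).
  exact: (component_count charK Q2 G3 B4 Q0 G0 F_normal Hirr He HG us hs).
have [a [b [Hab aU bU]]] := reducible_factors H0 HU Hred.
have ab0 : a * b != 0 by rewrite -Hab.
have ba0 : b * a != 0 by rewrite mulrC.
have ah : a \is (msize a).-1.-homog by apply: (@dhomog_factor _ _ e _ b); rewrite -?Hab.
have bh : b \is (msize b).-1.-homog.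
  by apply: (@dhomog_factor _ _ e _ a); rewrite // mulrC -Hab.
have e_sum : e = ((msize a).-1 + (msize b).-1)%N.
  by apply: (dhomog_uniq H0 He); rewrite Hab; apply: dhomogM.
have pos (q : {mpoly K[3]}) : q != 0 -> q \isn't a GRing.unit -> (0 < (msize q).-1)%N.
  by rewrite -msize_poly_eq0 mpoly_unit_msize; case: (msize q) => [|[]].
move: (ab0); rewrite mulf_eq0 negb_or => /andP[a0 b0].
have a_pos := pos a a0 aU; have b_pos := pos b b0 bU.
pose za (p : 'rV[K]_4) := a.@[base p 0] == 0; pose zb (p : 'rV[K]_4) := b.@[base p 0] == 0.
have aG : rdvd a G by apply: rdvd_trans HG; exists b.
have bG : rdvd b G by apply: rdvd_trans HG; exists a; rewrite mulrC.
have a_lt : ((msize a).-1 < e)%N by rewrite e_sum -addn1 leq_add2l.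
have b_lt : ((msize b).-1 < e)%N by rewrite e_sum -add1n leq_add2r.
have [|ha1 ha2] := IH _ a_lt a (filter za s) ah aG (filter_uniq _ us).
  by move=> p; rewrite mem_filter => /andP[/eqP ap /hs [gp _]].
have [|hb1 hb2] := IH _ b_lt b (filter zb s) bh bG (filter_uniq _ us).
  by move=> p; rewrite mem_filter => /andP[/eqP bp /hs [gp _]].
have hsum : (size s <= size (filter za s) + size (filter zb s))%N.
  rewrite !size_filter -(count_predC za s) leq_add2l.
  rewrite (@eq_in_count _ _ (predI (predC za) zb)); first by apply: sub_count => p /andP[].
  move=> p ps /=; have [_] := hs p ps; rewrite Hab mevalM => /eqP.
  by rewrite mulf_eq0 /za /zb; case: (_ == 0).
split=> [|dQ]; last have := hb2 dQ; last have := ha2 dQ.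
  move: hsum ha1 hb1 e_sum; clear; move: (size _) (size _) (size _) => i j k; lia.
move: hsum e_sum; clear; move: (size _) (size _) (size _) => i j k; lia.
Qed.

Lemma singular_scale p c : c != 0 -> singular_point F p -> singular_point F (c *: p).
Proof.
move=> c0 [p0 Fp dFp]; have Fh : F \is 4.-homog := taylor_form_homog Q2 G3 B4.
split; first by rewrite scaler_eq0 negb_or c0.
  by rewrite (meval_homog_scale (c := c) (v := p 0) Fh) => [|i]; rewrite ?Fp ?mulr0 // mxE.
move=> i; rewrite (meval_homog_scale (c := c) (v := p 0) (mderiv_homog i Fh)) ?dFp ?mulr0 // => j.
by rewrite mxE.
Qed.

Lemma taylor_card_sing : card_sing_le F 25 /\ ((forall i, Q^`M(i) = 0) -> card_sing_le F 16).
Proof.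
have main N : (forall s : seq 'rV[K]_4, uniq s -> (forall p, p \in s -> good_singular Q G B p) ->
    (size s <= N)%N) -> card_sing_le F N.+1.
  case/maximal_uniq_list => s sN sP; exists (cone_point (fun=> 0) 1 :: s); first exact: sN.
  move=> p sp; have [base0|base0] := eqVneq (base p) 0.
    exists (cone_point (fun=> 0) 1); first exact: mem_head.
    exists (height p); rewrite {1}(cone_pointE p) base0; apply/rowP => i; rewrite !mxE.
    by rewrite /extend_point; case: unlift => [j|]; rewrite ?mxE ?mulr0 ?mulr1.
  have [c c0 cE] := normalizeE base0.
  have bc : base (c *: p) = c *: base p by apply/rowP => i; rewrite !mxE.
  exists (c *: p); last by exists c^-1; rewrite scalerA mulVf // scale1r.
  rewrite inE; apply/orP; right; apply: sP; split; first exact: singular_scale.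
  rewrite /normalized bc scaler_eq0 negb_or c0 base0 /=.
  by rewrite normalize_scale // cE.
have count s : uniq s -> (forall p, p \in s -> good_singular Q G B p) ->
    (size s <= 24)%N /\ ((forall i, Q^`M(i) = 0) -> (size s <= 15)%N).
  move=> us hs; apply: (divisor_count G3 (rdvdxx G) us) => p /hs gp; split=> //.
  by have [sp _] := gp; exact: (singular_G charK sp).
split=> [|dQ]; apply: main => s us hs; first by have [] := count s us hs.
by have [_] := count s us hs; apply.
Qed.

End TaylorCount.

(** * Linear changes of coordinates *)

Section LinearChange.
Variable K : fieldType.
Implicit Types (S T : 'M[K]_4) (p : {mpoly K[4]}) (y : 'rV[K]_4).

Definition change_coord_morphism T : {rmorphism {mpoly K[4]} -> {mpoly K[4]}} :=
  comp_mpoly [tuple \sum_(j < 4) T j i *: 'X_j | i < 4].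
Local Notation cc := change_coord_morphism.

Lemma change_coordM T p q : change_coord (p * q) T = change_coord p T * change_coord q T.
Proof. exact: (rmorphM (cc T)). Qed.

Lemma change_coordB T p q : change_coord (p - q) T = change_coord p T - change_coord q T.
Proof. exact: (rmorphB (cc T)). Qed.

Lemma change_coordD T p q : change_coord (p + q) T = change_coord p T + change_coord q T.
Proof. exact: (rmorphD (cc T)). Qed.

Lemma change_coordXn T p n : change_coord (p ^+ n) T = change_coord p T ^+ n.
Proof. exact: (rmorphXn (cc T)). Qed.

Lemma change_coord_sum T n (f : 'I_n -> {mpoly K[4]}) :
  change_coord (\sum_i f i) T = \sum_i change_coord (f i) T.
Proof. exact: (raddf_sum (cc T)). Qed.

Lemma change_coordX T i : change_coord 'X_i T = \sum_j T j i *: 'X_j.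
Proof. by rewrite /change_coord comp_mpolyXU -tnth_nth tnth_mktuple. Qed.

Lemma meval_change_coord T p y : (change_coord p T).@[y 0] = p.@[(y *m T) 0].
Proof.
rewrite /change_coord comp_mpoly_meval; apply: meval_eq => i.
rewrite tnth_mktuple raddf_sum mxE /=; apply: eq_bigr => j _.
by rewrite mevalZ mevalXU mulrC.
Qed.

Lemma change_coord_homog T d p : p \is d.-homog -> change_coord p T \is d.-homog.
Proof.
apply: comp_mpoly_homog => i; rewrite tnth_mktuple; apply: rpred_sum => j _.
by apply: rpredZ; rewrite dhomogX /= mdeg1.
Qed.

Lemma change_coordK S T : S *m T = 1%:M -> cancel (fun p => change_coord p T) (fun p => change_coord p S).
Proof.
move=> ST p; apply: (mpoly_rmorph_ext (f := cc S \o cc T) (g := idfun)).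
  by move=> c; rewrite /= !comp_mpolyC.
move=> i; rewrite /= -/(change_coord 'X_i T) change_coordX -/(change_coord _ S) change_coord_sum.
transitivity (\sum_k (S *m T) k i *: ('X_k : {mpoly K[4]})).
  under eq_bigr => j _ do rewrite /change_coord comp_mpolyZ -/(change_coord _ _) change_coordX scaler_sumr.
  rewrite exchange_big /=; apply: eq_bigr => k _; rewrite mxE scaler_suml.
  by apply: eq_bigr => j _; rewrite scalerA mulrC.
rewrite ST (bigD1 i) //= mxE eqxx scale1r big1 ?addr0 // => k /negPf ki.
by rewrite mxE ki scale0r.
Qed.

(** Forms, their degrees, their values and divisibility are all carried over by
    the substitution, which has an inverse. *)
Lemma normal_change_coord F T : T \in unitmx -> normal_surface F ->
  normal_surface (change_coord F T).
Proof.
move=> Tu [Firr Fn]; pose S := invmx T.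
have KTS := change_coordK (mulVmx Tu : S *m T = 1%:M).
have KST := change_coordK (mulmxV Tu : T *m S = 1%:M).
split; first exact: (iso_irreducible (f := cc T) (g := cc S) KTS KST Firr).
move=> p p0 Fp d A D Ah Dh FD [n [e [c [E [ch Eh Ep Fdiv]]]]].
have pT0 : p *m T != 0.
  by apply: contraNneq p0 => h; rewrite -(mulmxK Tu p) h mul0mx.
have FpT : F.@[(p *m T) 0] = 0 by rewrite -meval_change_coord.
have evS q : (change_coord q S).@[(p *m T) 0] = q.@[p 0].
  by rewrite meval_change_coord mulmxK.
have [||||k [C [E' [C'h E'h E'p [H FH]]]]] := Fn (p *m T) pT0 FpT d (change_coord A S) (change_coord D S).
- exact: change_coord_homog.
- exact: change_coord_homog.
- case=> H DH; apply: FD; exists (change_coord H T).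
  have := congr1 (fun p => change_coord p T) DH; rewrite /= KST => ->.
  exact: change_coordM.
- exists n, e, (fun i => change_coord (c i) S), (change_coord E S); split.
  + by move=> i; apply: change_coord_homog.
  + exact: change_coord_homog.
  + by rewrite evS.
  case: Fdiv => H /(congr1 (fun p => change_coord p S)) /= e1.
  exists (change_coord H S); have -> : F * change_coord H S = change_coord (change_coord F T * H) S.
    by rewrite change_coordM KTS.
  rewrite -e1 change_coordD change_coordM change_coordXn change_coord_sum.
  by congr (_ + _); apply: eq_bigr => i _; rewrite !change_coordM !change_coordXn.
exists k, (change_coord C T), (change_coord E' T); split.
- exact: change_coord_homog.
- exact: change_coord_homog.
- by rewrite meval_change_coord.
exists (change_coord H T); have := congr1 (fun p => change_coord p T) FH.
by rewrite /= change_coordB !change_coordM !KST.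
Qed.

Lemma singular_change_coord F T y : T \in unitmx -> singular_point F y ->
  singular_point (change_coord F T) (y *m invmx T).
Proof.
move=> Tu [y0 Fy dFy]; split.
- by apply: contraNneq y0 => h; rewrite -(mulmxKV Tu y) h mul0mx.
- by rewrite meval_change_coord mulmxKV.
move=> i; rewrite /change_coord mderiv_comp raddf_sum /= big1 // => j _.
by rewrite mevalM -/(change_coord _ _) meval_change_coord mulmxKV // dFy mul0r.
Qed.

Lemma card_sing_change_coord F T N : T \in unitmx ->
  card_sing_le (change_coord F T) N -> card_sing_le F N.
Proof.
move=> Tu [s sN sP]; exists [seq q *m T | q <- s]; first by rewrite size_map.
move=> y /(singular_change_coord Tu) /sP [q qs [c yq]].
exists (q *m T); first exact: map_f.
by exists c; rewrite -(mulmxKV Tu y) yq scalemxAl.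
Qed.

End LinearChange.

(** * The bounds *)

Lemma card_sing_le_weaken (K : fieldType) (F : {mpoly K[4]}) M N :
  (M <= N)%N -> card_sing_le F M -> card_sing_le F N.
Proof. by move=> MN [s sM sP]; exists s => //; apply: leq_trans MN. Qed.

Theorem proposition5 (K : closedFieldType) (charK : 2%N \in [pchar K])
    (F : {mpoly K[4]}) (F_quartic : F \is 4.-homog) (F_normal : normal_surface F)
    (P : 'rV[K]_4) (P_double : double_point F P)
    (T : 'M[K]_4) (Q G B : {mpoly K[3]})
    (F_taylor : taylor_development F P T Q G B)
    (projection_separable : G != 0) :
  card_sing_le F 25 /\
  (Q = x1 ^+ 2 ->
   [/\ (exists H : {mpoly K[3]}, G = x1 * H) -> card_sing_le F 17,
       (exists l1 l2 n1 n2 : K,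
          G = x1 ^+ 2 * (l1 *: x1 + l2 *: x2)
              + x2 * x3 * (n1 *: x1 + n2 *: x2)) -> card_sing_le F 19
     & (exists l1 l2 l3 m2 m3 : K,
          G = x1 ^+ 2 * (l1 *: x1 + l2 *: x2 + l3 *: x3)
              + x1 * x2 * (m2 *: x2 + m3 *: x3) + x2 ^+ 3) ->
       card_sing_le F 19]).
Proof.
have [Tu _ [Q2 G3 B4] Q0 FE] := F_taylor.
have Fn : normal_surface (taylor_form Q G B).
  by rewrite /taylor_form -FE; apply: normal_change_coord.
have [c25 c16] := taylor_card_sing charK Q2 G3 B4 Q0 projection_separable Fn.
have pull N : card_sing_le (taylor_form Q G B) N -> card_sing_le F N.
  by rewrite /taylor_form -FE; apply: card_sing_change_coord.
split=> [|Qsq]; first exact: pull.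
have F16 : card_sing_le F 16.
  apply: pull; apply: c16 => i.
  by rewrite Qsq expr2 mderivM [_ * x1]mulrC (addrr_pchar2 (mpoly_pchar2 3 charK)).
by split=> _; apply: card_sing_le_weaken F16.
Qed.
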